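(* Let $X$ be baseline covariates with law $P(x)$, $A\in\{0,1\}$ an exposure, $M\in\{0,1\}$ a mediator, $Y$ a real-valued outcome, and $S_M\in\{0,1\}$ a (possibly unobserved) baseline variable, with potential outcomes $M(a)$, $Y(a,m)$, $Y(a)=Y(a,M(a))$. Suppose: (1) Consistency: if $A=a$ then $M=M(a)$; if additionally $M=m$ then $Y=Y(a,m)$. (2) Positivity: $P(A=a\mid X=x)>0$ and $P(M=m\mid A=a,X=x)>0$ for all $a,m\in\{0,1\}$ and almost every $x$. (3) Single-world ignorability: for all $a,m$, $\{Y(a,m),M(a)\}\perp A\mid X$ and $Y(a,m)\perp M\mid A=a,X$. (4) Necessity: $P(M(b)=1\mid S_M=0,X)=0$ for each $b\in\{0,1\}$. (5) Marker blinding: $S_M\perp A\mid X$. (6) Marker-conditional single-world exchangeability: for all $a,m$, $\{Y(a,m),M(a)\}\perp A\mid X,S_M$ and $Y(a,m)\perp M\mid A=a,X,S_M$. (7) Outcome-marker conditional independence: $Y\perp S_M\mid A,M,X$. **Part I.** Suppose in addition sufficiency-under-control: $P(M(0)=1\mid S_M=1,X)=1$. Then for $a\in\{0,1\}$, $$\mathbb{E}[Y(a,M(0))]=\int\sum_{m=0}^1\mathbb{E}[Y\mid A=a,M=m,X=x]\,P(M=m\mid A=0,X=x)\,dP(x).$$ For $s\in\{0,1\}$ with $P(S_M=s)>0$, the quantity $\Delta^{\text{dir-c}}_s:=\mathbb{E}[Y(1,s)-Y(0,s)\mid S_M=s]$ satisfies $$\Delta^{\text{dir-c}}_s=\int\{\mathbb{E}[Y\mid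 A=1,M=s,X=x]-\mathbb{E}[Y\mid A=0,M=s,X=x]\}\,dP(x\mid S_M=s),$$ where $$dP(x\mid S_M=s)=\frac{P(M=s\mid A=0,X=x)\,dP(x)}{\int P(M=s\mid A=0,X=x')\,dP(x')}.$$ If $P(S_M=1)>0$, the quantity $\Delta^{\text{indir-c}}_1:=\mathbb{E}[Y(1)-Y(1,1)\mid S_M=1]$ satisfies $$\Delta^{\text{indir-c}}_1=\Big\{\int P(M=1\mid A=0,x)\,dP(x)\Big\}^{-1}\int\sum_{m=0}^1\mathbb{E}[Y\mid A=1,m,x]\,\{P(m\mid A=1,x)-P(m\mid A=0,x)\}\,dP(x).$$ Consequently $$\mathbb{E}[Y(1,M(0))-Y(0,M(0))]=\Delta^{\text{dir-c}}_1P(S_M=1)+\Delta^{\text{dir-c}}_0P(S_M=0),$$ $$\mathbb{E}[Y(1,M(1))-Y(1,M(0))]=\Delta^{\text{indir-c}}_1P(S_M=1),$$ where $P(S_M=s)=\int P(M=s\mid A=0,X=x)\,dP(x)$, so these effects are identified from the law of $(X,A,M,Y)$. **Part II.** Suppose instead, in addition to (1)-(7), sufficiency-under-treatment: $P(M(1)=1\mid S_M=1,X)=1$. Then for $a\in\{0,1\}$, $$\mathbb{E}[Y(a,M(1))]=\int\sum_{m=0}^1\mathbb{E}[Y\mid A=a,M=m,X=x]\,P(M=m\mid A=1,X=x)\,dP(x).$$ For $s\in\{0,1\}$ with $P(S_M=s)>0$, the quantity $\Delta^{\text{dir-t}}_s:=\mathbb{E}[Y(1,s)-Y(0,s)\mid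 S_M=s]$ satisfies $$\Delta^{\text{dir-t}}_s=\int\{\mathbb{E}[Y\mid A=1,M=s,X=x]-\mathbb{E}[Y\mid A=0,M=s,X=x]\}\,dP(x\mid S_M=s),$$ where $$dP(x\mid S_M=s)=\frac{P(M=s\mid A=1,X=x)\,dP(x)}{\int P(M=s\mid A=1,X=x')\,dP(x')}.$$ If $P(S_M=1)>0$, the quantity $\Delta^{\text{indir-t}}_1:=\mathbb{E}[Y(0,1)-Y(0)\mid S_M=1]$ satisfies $$\Delta^{\text{indir-t}}_1=\Big\{\int P(M=1\mid A=1,x)\,dP(x)\Big\}^{-1}\int\sum_{m=0}^1\mathbb{E}[Y\mid A=0,m,x]\,\{P(m\mid A=1,x)-P(m\mid A=0,x)\}\,dP(x).$$ Consequently $$\mathbb{E}[Y(1,M(1))-Y(0,M(1))]=\Delta^{\text{dir-t}}_1P(S_M=1)+\Delta^{\text{dir-t}}_0P(S_M=0),$$ $$\mathbb{E}[Y(0,M(1))-Y(0,M(0))]=\Delta^{\text{indir-t}}_1P(S_M=1),$$ where $P(S_M=s)=\int P(M=s\mid A=1,X=x)\,dP(x)$.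
   Context: All variables, observed ($X,A,M,Y$), marker ($S_M$) and potential outcomes ($M(a)$, $Y(a,m)$ for $a,m\in\{0,1\}$), are random variables on one probability space. $Y(a,M(a'))$ denotes $Y(a,m)$ evaluated at the random value $m=M(a')$, and composition holds: $Y(a)=Y(a,M(a))$. $\perp$ denotes (conditional) independence. $P(m\mid A=a,x)$ abbreviates $P(M=m\mid A=a,X=x)$ and $\mathbb{E}[Y\mid A=a,m,x]$ abbreviates $\mathbb{E}[Y\mid A=a,M=m,X=x]$. Conditional statements given $S_M=s$ and $X$ are understood to hold almost surely wherever the conditioning event has positive conditional probability; all expectations displayed are assumed to exist and be finite. A product of a conditional expectation given $S_M=s$ with $P(S_M=s)$ is read as $0$ if $P(S_M=s)=0$. *)

(* Defs.v *)
From HB Require Import structures.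
From mathcomp Require Import all_boot all_order all_algebra.
From mathcomp Require Import all_classical all_reals all_analysis.

Set Implicit Arguments.
Unset Strict Implicit.
Unset Printing Implicit Defensive.

Import Order.TTheory GRing.Theory Num.Theory.
Import numFieldNormedType.Exports.

Local Open Scope classical_set_scope.
Local Open Scope ring_scope.

(* [g] is a version of z |-> E[Z | W = z] (Kolmogorov's definition); any two
   versions agree almost everywhere for the law of W. *)
Definition is_condexp d (T : measurableType d) (R : realType)
    (P : probability T R) dW (TW : measurableType dW) (W : T -> TW)
    (Z : T -> R) (g : TW -> R) : Prop :=
  [/\ measurable_fun [set: TW] g,
      P.-integrable [set: T] (fun w => (g (W w))%:E) &
      forall B : set TW, measurable B ->
        (\int[P]_(w in W @^-1` B) (g (W w))%:E =
         \int[P]_(w in W @^-1` B) (Z w)%:E)%E].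

(* z |-> E[Z | W = z]: a chosen version. One exists by Radon-Nikodym when W is
   measurable and Z is integrable; the default 0 is returned otherwise. *)
Definition condexp d (T : measurableType d) (R : realType)
    (P : probability T R) dW (TW : measurableType dW) (W : T -> TW)
    (Z : T -> R) : TW -> R :=
  xget (fun=> 0) [set g | is_condexp P W Z g].

(* z |-> P(E | W = z) *)
Definition condprob d (T : measurableType d) (R : realType)
    (P : probability T R) dW (TW : measurableType dW) (W : T -> TW)
    (E : set T) : TW -> R :=
  condexp P W (\1_E).

(* U and V are conditionally independent given W on the event {W \in D};
   D = setT is the usual conditional independence, and for instance
   W = (A, X), D = [set z | z.1 = a] is independence given (A = a, X).
   The factorization at W w for P-almost every w is the factorization at z for
   almost every z under the law of W. *)
Definition cond_indep_on d (T : measurableType d) (R : realType)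
    (P : probability T R) dU (TU : measurableType dU) dV (TV : measurableType dV)
    dW (TW : measurableType dW) (U : T -> TU) (V : T -> TV) (W : T -> TW)
    (D : set TW) : Prop :=
  forall (B : set TU) (C : set TV), measurable B -> measurable C ->
    {ae P, forall w, D (W w) ->
      condprob P W (U @^-1` B `&` V @^-1` C) (W w) =
      condprob P W (U @^-1` B) (W w) * condprob P W (V @^-1` C) (W w)}.

Definition cond_indep d (T : measurableType d) (R : realType)
    (P : probability T R) dU (TU : measurableType dU) dV (TV : measurableType dV)
    dW (TW : measurableType dW) (U : T -> TU) (V : T -> TV) (W : T -> TW) : Prop :=
  cond_indep_on P U V W [set: TW].

(* The values 0 and 1 of A, M, S_M and the potential outcomes' indices are
   [false] and [true]; [potM V a] is M(a) and [potY V a m] is Y(a,m). *)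
Record setting (R : realType) dX (TX : measurableType dX) := Setting {
  disp : measure_display ;
  Omega : measurableType disp ;
  Pr : probability Omega R ;
  covX : {RV Pr >-> TX} ;
  expA : {RV Pr >-> bool} ;
  medM : {RV Pr >-> bool} ;
  outY : {RV Pr >-> R} ;
  mrkS : {RV Pr >-> bool} ;
  potM : bool -> {RV Pr >-> bool} ;
  potY : bool -> bool -> {RV Pr >-> R} }.

(* Y(a, M(a')) *)
Definition Ycross (R : realType) dX (TX : measurableType dX)
    (V : setting R TX) (a a' : bool) (w : Omega V) : R :=
  potY V a (potM V a' w) w.

(* Y(a) = Y(a, M(a)) *)
Definition Ya (R : realType) dX (TX : measurableType dX)
    (V : setting R TX) (a : bool) : Omega V -> R :=
  Ycross a a.
Arguments Ycross {R dX TX} V a a' w.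
Arguments Ya {R dX TX} V a _.

Definition lawX (R : realType) dX (TX : measurableType dX)
    (V : setting R TX) : probability TX R :=
  distribution (Pr V) (covX V).

(* P(A = a | X = x) *)
Definition propensity (R : realType) dX (TX : measurableType dX)
    (V : setting R TX) (a : bool) (x : TX) : R :=
  condprob (Pr V) (covX V) [set w | expA V w = a] x.

(* P(M = m | A = a, X = x) *)
Definition pM (R : realType) dX (TX : measurableType dX)
    (V : setting R TX) (m a : bool) (x : TX) : R :=
  condprob (Pr V) (fun w => (expA V w, covX V w)) [set w | medM V w = m] (a, x).

(* E[Y | A = a, M = m, X = x] *)
Definition muY (R : realType) dX (TX : measurableType dX)
    (V : setting R TX) (a m : bool) (x : TX) : R :=
  condexp (Pr V) (fun w => (expA V w, medM V w, covX V w)) (outY V) (a, m, x).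

Definition consistency (R : realType) dX (TX : measurableType dX)
    (V : setting R TX) : Prop :=
  {ae Pr V, forall w, forall a, expA V w = a ->
    medM V w = potM V a w /\ forall m, medM V w = m -> outY V w = potY V a m w}.

Definition positivity (R : realType) dX (TX : measurableType dX)
    (V : setting R TX) : Prop :=
  {ae lawX V, forall x, forall a m, 0 < propensity V a x /\ 0 < pM V m a x}.

Definition single_world_ignorability (R : realType) dX (TX : measurableType dX)
    (V : setting R TX) : Prop :=
  forall a m,
    cond_indep (Pr V) (fun w => (potY V a m w, potM V a w)) (expA V) (covX V) /\
    cond_indep_on (Pr V) (potY V a m) (medM V)
      (fun w => (expA V w, covX V w)) [set z | z.1 = a].

(* P(M(b) = 1 | S_M = s, X) = p, almost surely on {S_M = s} *)
Definition marker_response (R : realType) dX (TX : measurableType dX)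
    (V : setting R TX) (b s : bool) (p : R) : Prop :=
  {ae Pr V, forall w, mrkS V w = s ->
    condprob (Pr V) (fun w' => (mrkS V w', covX V w')) [set w' | potM V b w' = true]
      (s, covX V w) = p}.

Definition necessity (R : realType) dX (TX : measurableType dX)
    (V : setting R TX) : Prop :=
  forall b, marker_response V b false 0.

Definition sufficiency_under_control (R : realType) dX (TX : measurableType dX)
    (V : setting R TX) : Prop :=
  marker_response V false true 1.

Definition sufficiency_under_treatment (R : realType) dX
    (TX : measurableType dX) (V : setting R TX) : Prop :=
  marker_response V true true 1.

Definition marker_blinding (R : realType) dX (TX : measurableType dX)
    (V : setting R TX) : Prop :=
  cond_indep (Pr V) (mrkS V) (expA V) (covX V).

Definition marker_exchangeability (R : realType) dX (TX : measurableType dX)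
    (V : setting R TX) : Prop :=
  forall a m,
    cond_indep (Pr V) (fun w => (potY V a m w, potM V a w)) (expA V)
      (fun w => (covX V w, mrkS V w)) /\
    cond_indep_on (Pr V) (potY V a m) (medM V)
      (fun w => (expA V w, covX V w, mrkS V w)) [set z | z.1.1 = a].

Definition outcome_marker_indep (R : realType) dX (TX : measurableType dX)
    (V : setting R TX) : Prop :=
  cond_indep (Pr V) (outY V) (mrkS V) (fun w => (expA V w, medM V w, covX V w)).

Record assumptions (R : realType) dX (TX : measurableType dX)
    (V : setting R TX) : Prop := Assumptions {
  a_consistency : consistency V ;
  a_positivity : positivity V ;
  a_ignorability : single_world_ignorability V ;
  a_necessity : necessity V ;
  a_blinding : marker_blinding V ;
  a_exchangeability : marker_exchangeability V ;
  a_outcome_marker : outcome_marker_indep V }.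

(* E|Y(a, M(a'))| < +oo *)
Definition Ycross_integrable (R : realType) dX (TX : measurableType dX)
    (V : setting R TX) (a a' : bool) : Prop :=
  (Pr V).-integrable [set: Omega V] (fun w => (Ycross V a a' w)%:E).

(* Finiteness of the three mean potential outcomes E[Y(0,M(b))], E[Y(1,M(b))]
   and E[Y(1-b)]; by consistency it makes Y integrable, hence E[Y | A, M, X]
   well defined. *)
Definition finite_means (R : realType) dX (TX : measurableType dX)
    (V : setting R TX) (b : bool) : Prop :=
  [/\ Ycross_integrable V false b, Ycross_integrable V true b &
      Ycross_integrable V (~~ b) (~~ b)].

Lemma measurable_S_eq (R : realType) dX (TX : measurableType dX)
    (V : setting R TX) (s : bool) : measurable (mrkS V @^-1` [set s]).
Proof. exact: measurable_funPTI. Qed.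

(* P(S_M = s) *)
Definition pS (R : realType) dX (TX : measurableType dX)
    (V : setting R TX) (s : bool) : \bar R :=
  Pr V (mrkS V @^-1` [set s]).

(* P( . | S_M = s): the restriction of P to {S_M = s}, normalized; by convention
   [mnormalize] gives P itself when P(S_M = s) = 0. *)
Definition Pr_given_S (R : realType) dX (TX : measurableType dX)
    (V : setting R TX) (s : bool) : probability (Omega V) R :=
  mnormalize (mrestr (Pr V) (measurable_S_eq V s)) (Pr V).

(* P(x | S_M = s) *)
Definition lawX_given_S (R : realType) dX (TX : measurableType dX)
    (V : setting R TX) (s : bool) : probability TX R :=
  distribution (Pr_given_S V s) (covX V).

(* E[Y(1,s) - Y(0,s) | S_M = s], which is both Delta^{dir-c}_s and
   Delta^{dir-t}_s *)
Definition Delta_dir (R : realType) dX (TX : measurableType dX)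
    (V : setting R TX) (s : bool) : \bar R :=
  ('E_(Pr_given_S V s)[(fun w => potY V true s w - potY V false s w)%R])%E.

(* E[Y(1) - Y(1,1) | S_M = 1] *)
Definition Delta_indir_c (R : realType) dX (TX : measurableType dX)
    (V : setting R TX) : \bar R :=
  ('E_(Pr_given_S V true)[(fun w => Ya V true w - potY V true true w)%R])%E.

(* E[Y(0,1) - Y(0) | S_M = 1] *)
Definition Delta_indir_t (R : realType) dX (TX : measurableType dX)
    (V : setting R TX) : \bar R :=
  ('E_(Pr_given_S V true)[(fun w => potY V false true w - Ya V false w)%R])%E.

(* E[Y(1,M(b)) - Y(0,M(b))] *)
Definition direct_effect (R : realType) dX (TX : measurableType dX)
    (V : setting R TX) (b : bool) : \bar R :=
  ('E_(Pr V)[(fun w => Ycross V true b w - Ycross V false b w)%R])%E.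

(* E[Y(a,M(1)) - Y(a,M(0))] *)
Definition indirect_effect (R : realType) dX (TX : measurableType dX)
    (V : setting R TX) (a : bool) : \bar R :=
  ('E_(Pr V)[(fun w => Ycross V a true w - Ycross V a false w)%R])%E.

(* The law of (X, A, M, Y) is the same in both settings. *)
Definition same_observed_law (R : realType) dX (TX : measurableType dX)
    (V V' : setting R TX) : Prop :=
  forall B : set (TX * bool * bool * R), measurable B ->
    Pr V ((fun w => (covX V w, expA V w, medM V w, outY V w)) @^-1` B) =
    Pr V' ((fun w => (covX V' w, expA V' w, medM V' w, outY V' w)) @^-1` B).

(* Main.v *)
Require Import Defs.
From HB Require Import structures.
From mathcomp Require Import all_boot all_order all_algebra.
From mathcomp Require Import all_classical all_reals all_analysis.
From mathcomp Require Import measurable_realfun.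
From mathcomp Require Import ring.

Import Order.TTheory GRing.Theory Num.Theory.
Import numFieldNormedType.Exports.
Import HBNNSimple.

Local Open Scope classical_set_scope.
Local Open Scope ring_scope.
Local Open Scope ereal_scope.

Set Implicit Arguments.
Unset Strict Implicit.
Unset Printing Implicit Defensive.

(* Necessity and sufficiency under arm b give M(b) = S_M almost surely, so the
   cross-world mean E[Y(a, M(b))] is the sum over m of E[Y(a,m) 1{S_M = m}], in
   which only single-world quantities occur. Given X and S_M = m, exchangeability
   replaces Y(a,m) by Y(a,m) 1{A = a, M = m} divided by the conditional density
   of (A, M) at (a, m); consistency replaces Y(a,m) by Y on that event, and the
   conditional independence of Y and S_M replaces Y by its regression on
   (A, M, X). Undoing the weighting yields
   E[Y(a,m) 1{S_M = m}] = E[mu(a,m,X) 1{S_M = m}], and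
   P(S_M = m | X) = P(M = m | A = b, X) by ignorability.

   Every conditional independence is used in the integrated form
   E[h(U,W) 1{V in C}] = E[h(U,W) P(V in C | W)] for measurable h >= 0, so that
   no conditional expectation of an unbounded potential outcome is needed. *)

(** * Transfer of integral identities *)

(** Three obstacles shape the details. Only the means of Y(a,M(b)) and of Y in the other arm are
    assumed finite, so Y(a,m) is controlled on {S_M = m} but perhaps not elsewhere. Identities are
    therefore proved for nonnegative test functions, where both sides may be infinite, and carried
    to signed ones through |h|. Next, the weight P(S_M = m | A, M, X) involves the possibly
    unobserved marker. It accompanies both Y and the regression of Y on (A, M, X), so passing from
    one to the other and back removes it without evaluating it. Finally, dividing by the density of
    (A, M) given X and S_M = m requires positivity inside the marker stratum, whereas positivity is
    assumed given X alone; it has to be derived, and necessity is what makes this possible. The mean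
    of Y(a) in the arm a other than b cannot pass through the marker, since M(a) and S_M may differ.
    It follows from the same weighting with {M(a) = m} in place of {S_M = m}. *)

Lemma integral_indicM d (T : measurableType d) (R : realType)
    (mu : {measure set T -> \bar R}) (A : set T) (f : T -> R) :
  \int[mu]_w (\1_A w * f w)%:E = \int[mu]_(w in A) (f w)%:E.
Proof.
rewrite [RHS]integral_mkcond; apply: eq_integral => w _.
by rewrite patchE indicE; case: ifPn => _; rewrite ?mul1r ?mul0r.
Qed.

Lemma integral_indic_preimage d (T : measurableType d) (R : realType)
    (mu : {measure set T -> \bar R}) (T' : Type) (F : T -> T') (B : set T')
    (f : T -> R) :
  \int[mu]_w (\1_B (F w) * f w)%:E = \int[mu]_(w in F @^-1` B) (f w)%:E.
Proof. exact: (integral_indicM _ (F @^-1` B)). Qed.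

Section transfer.
Context d (T : measurableType d) (R : realType) (P : probability T R).
Context d' (T' : measurableType d') (F : T -> T').
Hypothesis mF : measurable_fun setT F.

Lemma cvg_integral_nnsfun_comp (h : T' -> R) (mh : measurable_fun setT h)
    (mh' : measurable_fun setT (fun z => (h z)%:E)) (u : T -> R) :
  (forall z, 0 <= h z)%R -> measurable_fun setT u -> (forall w, 0 <= u w)%R ->
  (fun n => \int[P]_w (nnsfun_approx measurableT mh' n (F w) * u w)%:E) @ \oo -->
  \int[P]_w (h (F w) * u w)%:E.
Proof.
move=> h0 mu u0; set g := nnsfun_approx _ _.
have -> : \int[P]_w (h (F w) * u w)%:E =
    \int[P]_w limn (fun n => (g n (F w) * u w)%:E).
  apply: eq_integral => w _; apply/esym/cvg_lim => //.
  under eq_fun do rewrite EFinM.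
  rewrite EFinM; apply: cvgeZr => //.
  by apply: (@cvg_nnsfun_approx _ _ _ _ measurableT _ mh') => // z _ /=; rewrite lee_fin.
apply: cvg_monotone_convergence => //.
- move=> n; apply/measurable_EFinP; apply: measurable_funM => //.
  exact: measurableT_comp.
- by move=> n w _; rewrite lee_fin mulr_ge0.
- move=> w _ m n mn; rewrite lee_fin ler_wpM2r//.
  exact/lefP/nd_nnsfun_approx.
Qed.

Lemma ge0_integral_nnsfun_comp (h : {nnsfun T' >-> R}) (u : T -> R) :
  measurable_fun setT u -> (forall w, 0 <= u w)%R ->
  \int[P]_w (h (F w) * u w)%:E =
  \sum_(r \in range h) r%:E * \int[P]_w (\1_(h @^-1` [set r]) (F w) * u w)%:E.
Proof.
move=> mu u0.
have m1 r : measurable_fun setT (fun w => \1_(h @^-1` [set r]) (F w) * u w)%R.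
  apply: measurable_funM => //.
  apply: (@measurableT_comp _ _ _ _ _ _ (\1_(h @^-1` [set r]) : T' -> R)) => //.
transitivity (\int[P]_w \sum_(r \in range h)
    (r * (\1_(h @^-1` [set r]) (F w) * u w))%:E).
  apply: eq_integral => w _.
  rewrite {1}(fimfunE h) !fsbig_finite//= mulr_suml sumEFin.
  by congr EFin; apply: eq_bigr => r _; rewrite mulrA.
(* The sum lemma wants every term nonnegative, also at r outside the range of [h]; a negative r has
   an empty preimage, so its term is 0. *)
have ge0 r w : (0 <= r * (\1_(h @^-1` [set r]) (F w) * u w))%R.
  have [r0|r0] := leP 0%R r; first by rewrite !mulr_ge0.
  by rewrite preimage_nnfun0// indic0 mul0r mulr0.
rewrite ge0_integral_fsum//.
- apply: eq_fsbigr => r _.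
  have [r0|r0] := leP 0%R r; last first.
    rewrite preimage_nnfun0//.
    under eq_integral do rewrite indic0 mul0r mulr0.
    under [X in _ = _ * X]eq_integral do rewrite indic0 mul0r.
    by rewrite integral0 mule0.
  under eq_integral do rewrite EFinM.
  rewrite ge0_integralZl//; first exact/measurable_EFinP.
  by move=> w _; rewrite lee_fin mulr_ge0.
- by move=> r; apply/measurable_EFinP; exact: measurable_funM.
- by move=> r w _; rewrite lee_fin.
Qed.

(** Standard extension from indicators to simple functions to monotone limits. Since everything is
    nonnegative, both sides may be +oo and [h] needs no integrability. *)
Lemma ge0_eq_integral_comp (u v : T -> R) :
  measurable_fun setT u -> (forall w, 0 <= u w)%R ->
  measurable_fun setT v -> (forall w, 0 <= v w)%R ->
  (forall B, measurable B ->
    \int[P]_w (\1_B (F w) * u w)%:E = \int[P]_w (\1_B (F w) * v w)%:E) ->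
  forall h : T' -> R, measurable_fun setT h -> (forall z, 0 <= h z)%R ->
    \int[P]_w (h (F w) * u w)%:E = \int[P]_w (h (F w) * v w)%:E.
Proof.
move=> mu u0 mv v0 uv h mh h0.
have mh' : measurable_fun setT (fun z => (h z)%:E) by exact/measurable_EFinP.
have cu := cvg_integral_nnsfun_comp mh mh' h0 mu u0.
have cv := cvg_integral_nnsfun_comp mh mh' h0 mv v0.
rewrite -(cvg_lim _ cu)// -(cvg_lim _ cv)//; congr (limn _).
apply/funext => n; rewrite !ge0_integral_nnsfun_comp//.
by apply: eq_fsbigr => r _; rewrite uv//; exact: measurable_funPTI.
Qed.

End transfer.

Section transfer_rectangles.
Context d (T : measurableType d) (R : realType) (P : probability T R).
Context d1 (T1 : measurableType d1) d2 (T2 : measurableType d2).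
Variables (F1 : T -> T1) (F2 : T -> T2).
Hypotheses (mF1 : measurable_fun setT F1) (mF2 : measurable_fun setT F2).

(** Dynkin's argument: rectangles form a pi-system generating the product sigma-algebra.
    Integrability makes the integrals finite, which the subtraction in the complement step needs. *)
Lemma eq_integral_prod (u v : T -> R) :
  P.-integrable setT (EFin \o u) -> P.-integrable setT (EFin \o v) ->
  (forall B C, measurable B -> measurable C ->
    \int[P]_(w in F1 @^-1` B `&` F2 @^-1` C) (u w)%:E =
    \int[P]_(w in F1 @^-1` B `&` F2 @^-1` C) (v w)%:E) ->
  forall D : set (T1 * T2), measurable D ->
    \int[P]_(w in (fun w => (F1 w, F2 w)) @^-1` D) (u w)%:E =
    \int[P]_(w in (fun w => (F1 w, F2 w)) @^-1` D) (v w)%:E.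
Proof.
move=> iu iv uv; set F := fun w => _.
have mF : measurable_fun setT F by exact: measurable_fun_pair.
have mFp D : measurable D -> measurable (F @^-1` D).
  by move=> mD; rewrite -[X in measurable X]setTI; exact: mF.
have uvT : \int[P]_w (u w)%:E = \int[P]_w (v w)%:E.
  by have := uv setT setT measurableT measurableT; rewrite !preimage_setT setTI.
have fi f (D : set T) : P.-integrable setT (EFin \o f) -> measurable D ->
    \int[P]_(w in D) (f w)%:E \is a fin_num.
  by move=> fi mD; apply: integrable_fin_num => //; exact: integrableS fi.
have mP := @measurable_prod_measurableType _ _ T1 T2.
rewrite mP; apply: (dynkin_induction (G := [set A `*` B | A in measurable & B in measurable])).
- exact: mP.
- move=> _ _ [A1 mA1 [A2 mA2 <-]] [B1 mB1 [B2 mB2 <-]].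
  exists (A1 `&` B1); first exact: measurableI.
  exists (A2 `&` B2); first exact: measurableI.
  by rewrite setXI.
- by rewrite preimage_setT.
- by move=> _ [A mA [B mB <-]]; exact: uv.
- move=> D mD IH; rewrite preimage_setC.
  have split_ f : P.-integrable setT (EFin \o f) ->
      \int[P]_w (f w)%:E = \int[P]_(w in F @^-1` D) (f w)%:E +
        \int[P]_(w in ~` (F @^-1` D)) (f w)%:E.
    move=> If; rewrite -integral_setU ?setUv//.
    - exact: mFp.
    - by apply: measurableC; exact: mFp.
    - exact: (measurable_int P).
    - exact/disj_setPCl.
  have := uvT; rewrite (split_ u)// (split_ v)// IH.
  move=> /(congr1 (fun x => x - \int[P]_(w in F @^-1` D) (v w)%:E)).
  have fv : \int[P]_(w in F @^-1` D) (v w)%:E \is a fin_num.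
    by apply: fi => //; exact: mFp.
  by rewrite /= [X in X - _]addeC [X in _ = X - _]addeC !addeK.
- move=> G mG tG IH; rewrite preimage_bigcup.
  have tFG : trivIset setT (fun k => F @^-1` G k).
    apply/trivIsetP => i j _ _ ij.
    by rewrite -preimage_setI; move/trivIsetP: tG => -> //; rewrite preimage_set0.
  rewrite !integral_bigcup//.
  + by apply: eq_eseriesr => i _; exact: IH.
  + by move=> i; exact: mFp.
  + apply: integrableS iv => //.
    by apply: bigcup_measurable => k _; exact: mFp.
  + by move=> i; exact: mFp.
  + apply: integrableS iu => //.
    by apply: bigcup_measurable => k _; exact: mFp.
Qed.

End transfer_rectangles.

(** * Nonnegative versions of conditional expectations *)

Lemma ae_integrable d (T : measurableType d) (R : realType)
    (mu : {measure set T -> \bar R}) (f g : T -> R) :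
  measurable_fun setT g -> {ae mu, forall w, f w = g w} ->
  mu.-integrable setT (fun w => (f w)%:E) ->
  mu.-integrable setT (fun w => (g w)%:E).
Proof.
move=> mg fg /integrableP[mf foo]; apply/integrableP; split.
  exact/measurable_EFinP.
move: foo; rewrite (@ge0_ae_eq_integral _ _ _ mu setT _ (fun w => `|(g w)%:E|))//.
- exact: measurableT_comp.
- by do 2 apply: measurableT_comp => //.
- by apply: filterS fg => w ->.
Qed.

Section conditional_expectation.
Context d (T : measurableType d) (R : realType) (P : probability T R).
Context dW (TW : measurableType dW) (W : T -> TW).
Hypothesis mW : measurable_fun setT W.

Let mpre B : measurable B -> measurable (W @^-1` B).
Proof. by move=> mB; rewrite -[X in measurable X]setTI; exact: mW. Qed.

Let Wrv : {mfun T >-> TW} := HB.pack W (isMeasurableFun.Build _ _ _ _ W mW).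

Let Pint0 (f : T -> R) : P.-integrable setT (fun w => (f w)%:E) ->
  measurable_fun setT f.
Proof. by move=> /(measurable_int P)/measurable_EFinP. Qed.

(** The charge obtained by integrating Z over events is pushed forward along W. It is dominated by
    the law of W, and its derivative there is a version; the derivative is finite everywhere, so
    [fine] loses nothing. *)
Lemma is_condexp_exists (Z : T -> R) : P.-integrable setT (fun w => (Z w)%:E) ->
  exists g, is_condexp P W Z g.
Proof.
move=> iZ.
pose nu0 : {charge set T -> \bar R} := induced_charge iZ.
have nu0P : nu0 `<< P.
  apply/null_content_dominatesP => A mA PA0.
  rewrite /nu0 /= /induced_charge null_set_integral//.
    by apply: measurable_funTS; exact: (measurable_int P).
have [nu nuE] : exists nu : {charge set TW -> \bar R},
    forall B, nu B = nu0 (W @^-1` B).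
  by unshelve refine (ex_intro _ (pushforward nu0 W : {charge set TW -> \bar R}) _).
have numu : nu `<< distribution P Wrv.
  apply/null_content_dominatesP => B mB PB.
  by rewrite nuE; apply: (null_content_dominatesP _ _).1 nu0P _ _ _ => //; exact: mpre.
have fg := Radon_Nikodym_fin_num _ numu.
have ig := Radon_Nikodym_integrable numu.
have Ig := Radon_Nikodym_integral numu.
set g := Radon_Nikodym _ _ in fg ig Ig.
have mg : measurable_fun setT g by exact: measurable_int ig.
have gE : (fun w => (fine (g (W w)))%:E) = g \o W.
  by apply/funext => w /=; rewrite fineK.
have igW : P.-integrable setT (g \o W).
  apply/integrableP; split; first exact: measurableT_comp.
  case/integrableP: ig => _; rewrite ge0_integral_distribution//.
  exact: measurableT_comp.
exists (fine \o g); split => //=.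
- exact: measurableT_comp.
- by rewrite gE.
- move=> B mB; rewrite gE.
  have := Ig _ mB; rewrite nuE /nu0 /= /induced_charge => ->.
  rewrite -integral_pushforward//.
  by apply: integrableS igW => //; exact: mpre.
Qed.

Lemma condexpP (Z : T -> R) : P.-integrable setT (fun w => (Z w)%:E) ->
  is_condexp P W Z (condexp P W Z).
Proof. by move=> iZ; apply: xgetPex; exact: is_condexp_exists. Qed.

Lemma ae_distribution (X : {mfun T >-> TW}) (Q : TW -> Prop) :
  {ae distribution P X, forall z, Q z} -> {ae P, forall w, Q (X w)}.
Proof.
move=> [N [mN N0 NQ]]; exists (X @^-1` N); split => //.
- exact: measurable_funPTI.
- by move=> w /= nQ; exact: NQ.
Qed.

(** Under the law of W the two defining identities become equality of integrals over every
    measurable set, which forces equality almost everywhere; this is then pulled back along W. *)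
Lemma is_condexp_ae (Z : T -> R) (g1 g2 : TW -> R) :
  is_condexp P W Z g1 -> is_condexp P W Z g2 ->
  {ae P, forall w, g1 (W w) = g2 (W w)}.
Proof.
move=> [mg1 ig1 Ig1] [mg2 ig2 Ig2].
have [mE1 mE2] : measurable_fun setT (fun z => (g1 z)%:E) /\
    measurable_fun setT (fun z => (g2 z)%:E) by split; exact/measurable_EFinP.
have igW (g : TW -> R) : measurable_fun setT (fun z => (g z)%:E) ->
    P.-integrable setT (fun w => (g (W w))%:E) ->
    (distribution P Wrv).-integrable setT (fun z => (g z)%:E).
  by move=> mg ig; exact: integrable_pushforward.
have /(ae_distribution (X := Wrv)) : ae_eq (distribution P Wrv) setT
    (fun z => (g1 z)%:E) (fun z => (g2 z)%:E).
  apply: integral_ae_eq => //; first exact: igW.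
  move=> E _ mE.
  rewrite !integral_pushforward//=.
  - by rewrite -[LHS]/(\int[P]_(w in W @^-1` E) (g1 (W w))%:E)
               -[RHS]/(\int[P]_(w in W @^-1` E) (g2 (W w))%:E) Ig1// Ig2.
  - by apply: integrableS ig2 => //; exact: mpre.
  - by apply: integrableS ig1 => //; exact: mpre.
by apply: filterS => w /(_ I) [].
Qed.

Lemma integrable_indic1 (A : set T) : measurable A ->
  P.-integrable setT (fun w => (\1_A w)%:E : \bar R).
Proof. by move=> mA; apply: integrable_indic => //; rewrite ltey_eq fin_num_measure. Qed.

(* A nonnegative version of the conditional expectation of a nonnegative
   variable: the chosen version may be negative on a null set. *)
Definition condexp0 (Z : T -> R) (z : TW) : R := Num.max 0%R (condexp P W Z z).

Lemma condexp0_ge0 Z z : (0 <= condexp0 Z z)%R.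
Proof. by rewrite /condexp0 le_max lexx. Qed.

Section nonnegative_version.
Variable Z : T -> R.
Hypotheses (iZ : P.-integrable setT (fun w => (Z w)%:E))
  (Z0 : forall w, (0 <= Z w)%R).

Lemma measurable_condexp0 : measurable_fun setT (condexp0 Z).
Proof. by have [m _ _] := condexpP iZ; exact: measurable_maxr. Qed.

(** On the event where the version g is negative, the integral of -g is nonnegative, yet it equals
    minus the integral of Z >= 0. Hence it is 0, while -g is positive there, so the event is
    null. *)
Lemma condexp0_ae : {ae P, forall w, condexp P W Z (W w) = condexp0 Z (W w)}.
Proof.
have [mg ig Ig] := condexpP iZ.
set g := condexp P W Z in mg ig Ig *.
pose B := [set z | (g z < 0)%R].
have mB : measurable B.
  rewrite (_ : B = g @^-1` `]-oo, 0%R[); last first.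
    by apply/seteqP; split => z /=; rewrite in_itv.
  by rewrite -[X in measurable X]setTI; exact: mg.
have PB : P (W @^-1` B) = 0.
  have mWB := mpre mB.
  have I0 : \int[P]_(w in W @^-1` B) (- g (W w))%:E = 0.
    apply/eqP; rewrite eq_le; apply/andP; split; last first.
      by apply: integral_ge0 => w /= gw; rewrite lee_fin oppr_ge0 ltW.
    under eq_integral do rewrite EFinN.
    rewrite integralN/=; last first.
      apply: integrable_add_def => //; exact: integrableS ig.
    by rewrite Ig// oppe_le0 integral_ge0// => w _; rewrite lee_fin.
  have mng : measurable_fun (W @^-1` B) (fun w => (- g (W w))%:E).
    apply/measurable_EFinP/measurable_funTS; apply: measurableT_comp => //.
    exact: measurableT_comp.
  have ae0 : ae_eq P (W @^-1` B) (fun w => (- g (W w))%:E) (cst 0).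
    apply/ae_eq_integral_abs => //.
    rewrite -[RHS]I0; apply: eq_integral => w; rewrite inE /B /= => gw.
    by rewrite ger0_norm// oppr_ge0 ltW.
  apply: measure_negligible => //.
  move: ae0; rewrite /ae_eq; apply: negligibleS => w /= gw h.
  by move: (h gw) => /= [] /eqP; rewrite oppr_eq0 lt_eqF.
exists (W @^-1` B); split => //; first exact: mpre.
move=> w /= h; rewrite /B /= ltNge; apply/negP => g0; apply: h.
by rewrite /condexp0 max_r.
Qed.

Lemma is_condexp_condexp0 : is_condexp P W Z (condexp0 Z).
Proof.
have [mg ig Ig] := condexpP iZ.
have m0 := measurable_condexp0.
have m0W : measurable_fun setT (fun w => (condexp0 Z (W w))%:E).
  by apply/measurable_EFinP; exact: measurableT_comp.
split => //.
- apply: ae_integrable ig; first exact: measurableT_comp.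
  exact: condexp0_ae.
- move=> B mB; rewrite -Ig//; apply/esym/ae_eq_integral.
  + exact: mpre.
  + by apply: measurable_funTS; exact: (measurable_int P).
  + exact: measurable_funTS.
  + by apply: filterS condexp0_ae => w ->.
Qed.

(** The pull-out property for nonnegative factors, with no integrability of the product. *)
Lemma ge0_integral_condexp0 (h : TW -> R) :
  measurable_fun setT h -> (forall z, 0 <= h z)%R ->
  \int[P]_w (h (W w) * Z w)%:E = \int[P]_w (h (W w) * condexp0 Z (W w))%:E.
Proof.
have [m0 i0 I0] := is_condexp_condexp0.
apply: ge0_eq_integral_comp => //.
- exact: Pint0.
- exact: measurableT_comp.
- by move=> w; exact: condexp0_ge0.
- by move=> B mB; rewrite !integral_indic_preimage I0.
Qed.

End nonnegative_version.

Definition condprob0 (A : set T) : TW -> R := condexp0 (\1_A).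

Lemma measurable_condprob0 A : measurable A -> measurable_fun setT (condprob0 A).
Proof. by move=> mA; exact/measurable_condexp0/integrable_indic1. Qed.

Lemma integrable_condprob0 A : measurable A ->
  P.-integrable setT (fun w => (condprob0 A (W w))%:E).
Proof.
move=> mA; have [] // := @is_condexp_condexp0 (\1_A) _ _.
exact: integrable_indic1.
Qed.

Lemma condprob0_ae A : measurable A ->
  {ae P, forall w, condprob P W A (W w) = condprob0 A (W w)}.
Proof. by move=> mA; apply: condexp0_ae => //; exact: integrable_indic1. Qed.

Lemma ge0_integral_condprob0 A (h : TW -> R) : measurable A ->
  measurable_fun setT h -> (forall z, 0 <= h z)%R ->
  \int[P]_w (h (W w) * \1_A w)%:E = \int[P]_w (h (W w) * condprob0 A (W w))%:E.
Proof.
by move=> mA mh h0; apply: ge0_integral_condexp0 => //; exact: integrable_indic1.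
Qed.

(** Pull-out for signed Z and unbounded f. The parts of Z are treated separately with nonnegative
    versions; f times each part is dominated by f|Z|, so all four integrals are finite. Uniqueness
    of versions then passes from the difference to [g]. *)
Lemma integral_condexpM (Z : T -> R) (g f : TW -> R) :
  P.-integrable setT (fun w => (Z w)%:E) -> is_condexp P W Z g ->
  measurable_fun setT f -> (forall z, 0 <= f z)%R ->
  P.-integrable setT (fun w => (f (W w) * Z w)%:E) ->
  P.-integrable setT (fun w => (f (W w) * g (W w))%:E) /\
  \int[P]_w (f (W w) * g (W w))%:E = \int[P]_w (f (W w) * Z w)%:E.
Proof.
move=> iZ gP mf f0 ifZ; have mZ := Pint0 iZ; have [mg ig Ig] := gP.
have mfW : measurable_fun setT (f \o W) by exact: measurableT_comp.
have mgW : measurable_fun setT (g \o W) by exact: measurableT_comp.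
have iZp : P.-integrable setT (fun w => (Z^\+ w)%:E) by exact: integrable_funrpos.
have iZn : P.-integrable setT (fun w => (Z^\- w)%:E) by exact: integrable_funrneg.
have [mp ip Ip] := is_condexp_condexp0 iZp (funrpos_ge0 _).
have [mn i_n In] := is_condexp_condexp0 iZn (funrneg_ge0 _).
set gp := condexp0 _ in mp ip Ip; set gn := condexp0 _ in mn i_n In.
have [mgpW mgnW] : measurable_fun setT (gp \o W) /\ measurable_fun setT (gn \o W).
  by split; exact: measurableT_comp.
have ge : {ae P, forall w, (gp (W w) - gn (W w) = g (W w))%R}.
  have : is_condexp P W Z (fun z => gp z - gn z)%R.
    split.
    - exact: measurable_funB.
    - by under eq_fun do rewrite EFinB; exact: integrableB.
    - move=> B mB.
      have mWB := mpre mB.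
      have iB (k : T -> R) : P.-integrable setT (fun w => (k w)%:E) ->
        P.-integrable (W @^-1` B) (fun w => (k w)%:E) by exact: integrableS.
      under eq_integral do rewrite EFinB.
      rewrite integralB//; [|exact: iB|exact: iB].
      rewrite Ip// In// -integralB//; [|exact: iB|exact: iB].
      by apply: eq_integral => w _; rewrite -EFinB -[in RHS](funrposBneg Z).
  by move=> /is_condexp_ae/(_ gP).
have fZ (s : T -> R) (gs : TW -> R) : measurable_fun setT s ->
    (forall w, 0 <= s w)%R -> (forall z, 0 <= gs z)%R -> measurable_fun setT gs ->
    (forall w, s w <= `|Z w|)%R ->
    \int[P]_w (f (W w) * s w)%:E = \int[P]_w (f (W w) * gs (W w))%:E ->
    P.-integrable setT (fun w => (f (W w) * s w)%:E) /\
    P.-integrable setT (fun w => (f (W w) * gs (W w))%:E).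
  move=> ms s0 gs0 mgs sZ sgs.
  have is_ : P.-integrable setT (fun w => (f (W w) * s w)%:E).
    apply: le_integrable ifZ => //.
      by apply/measurable_EFinP; exact: measurable_funM.
    by move=> w _; rewrite /= lee_fin !normrM ler_wpM2l// ger0_norm.
  split => //; apply/integrableP; split.
    by apply/measurable_EFinP; apply: measurable_funM => //; exact: measurableT_comp.
  under eq_integral do rewrite /= ger0_norm ?mulr_ge0//.
  rewrite -sgs; case/integrableP: is_ => _; apply: le_lt_trans.
  by under [leRHS]eq_integral do rewrite /= ger0_norm ?mulr_ge0//.
have Zple w : (Z^\+ w <= `|Z w|)%R.
  by rewrite /funrpos ge_max ler_norm normr_ge0.
have Znle w : (Z^\- w <= `|Z w|)%R.
  by rewrite /funrneg ge_max -normrN ler_norm normr_ge0.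
have Ep := ge0_integral_condexp0 iZp (funrpos_ge0 _) mf f0.
have En := ge0_integral_condexp0 iZn (funrneg_ge0 _) mf f0.
have [ifp ifgp] : _ /\ _ := fZ _ gp (Pint0 iZp) (funrpos_ge0 _)
  (condexp0_ge0 _) mp Zple Ep.
have [ifn ifgn] : _ /\ _ := fZ _ gn (Pint0 iZn) (funrneg_ge0 _)
  (condexp0_ge0 _) mn Znle En.
have ifB : P.-integrable setT (fun w => (f (W w) * (gp (W w) - gn (W w)))%:E).
  by under eq_fun do rewrite mulrBr EFinB; exact: integrableB.
have mfg : measurable_fun setT (fun w => f (W w) * g (W w))%R.
  exact: measurable_funM.
split.
- by apply: ae_integrable ifB => //; apply: filterS ge => w ->.
- transitivity (\int[P]_w (f (W w) * (gp (W w) - gn (W w)))%:E).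
    apply: ae_eq_integral => //.
    + exact/measurable_EFinP.
    + exact: (measurable_int P).
    + by apply: filterS ge => w ->.
  under eq_integral do rewrite mulrBr EFinB.
  rewrite integralB// -Ep -En -integralB//.
  by apply: eq_integral => w _; rewrite -EFinB -mulrBr -[in RHS](funrposBneg Z).
Qed.

End conditional_expectation.

(** The identity at |h| transfers integrability, those at the two parts of h give the value. Two
    maps [F] and [F'] are allowed because one side carries the potential outcome and the other the
    observed one. *)
Lemma eq_integral_comp_signed d (T : measurableType d) (R : realType)
    (P : {measure set T -> \bar R}) d' (T' : measurableType d')
    (F F' : T -> T') (u v : T -> R) :
  measurable_fun setT F' -> (forall w, 0 <= u w)%R ->
  measurable_fun setT v -> (forall w, 0 <= v w)%R ->
  (forall h : T' -> R, measurable_fun setT h -> (forall z, 0 <= h z)%R ->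
    \int[P]_w (h (F w) * u w)%:E = \int[P]_w (h (F' w) * v w)%:E) ->
  forall h : T' -> R, measurable_fun setT h ->
    P.-integrable setT (fun w => (h (F w) * u w)%:E) ->
    P.-integrable setT (fun w => (h (F' w) * v w)%:E) /\
    \int[P]_w (h (F w) * u w)%:E = \int[P]_w (h (F' w) * v w)%:E.
Proof.
move=> mF' u0 mv v0 uv h mh ih; split.
- apply/integrableP; split.
    apply/measurable_EFinP; apply: measurable_funM => //.
    exact: measurableT_comp.
  have := uv (fun z => `|h z|)%R; case/integrableP: ih => _ + E.
  have nE (G : T -> T') (k : T -> R) : (forall w, 0 <= k w)%R ->
      \int[P]_w `|(h (G w) * k w)%:E| = \int[P]_w (`|h (G w)| * k w)%:E.
    by move=> k0; apply: eq_integral => w _; rewrite /= normrM (ger0_norm (k0 w)).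
  by rewrite !nE// E//; exact: measurableT_comp.
- have pE (G : T -> T') (k : T -> R) : (forall w, 0 <= k w)%R ->
      \int[P]_w (h (G w) * k w)%:E =
      \int[P]_w (h^\+ (G w) * k w)%:E - \int[P]_w (h^\- (G w) * k w)%:E.
    move=> k0; rewrite integralE; congr (_ - _); apply: eq_integral => w _.
    + by rewrite funeposE /funrpos -EFin_max maxr_pMl// mul0r.
    + by rewrite funenegE /funrneg -EFinN -EFin_max maxr_pMl// mul0r mulNr.
  rewrite !pE//; congr (_ - _); apply: uv => //.
  + exact: measurable_funrpos.
  + exact: measurable_funrneg.
Qed.

(** * Conditional independence *)

Section conditional_independence.
Context d (T : measurableType d) (R : realType) (P : probability T R).
Context dU (TU : measurableType dU) dV (TV : measurableType dV)
  dW (TW : measurableType dW).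
Variables (U : T -> TU) (V : T -> TV) (W : T -> TW).
Hypotheses (mU : measurable_fun setT U) (mV : measurable_fun setT V)
  (mW : measurable_fun setT W).

(** It suffices to take for h the indicator of a rectangle in (U, W). There one conditions on W,
    applies the factorization, and undoes the conditioning for the factor that concerns U. *)
Lemma cond_indep_on_integral (D : set TW) (C : set TV) (h : TU * TW -> R) :
  measurable D -> measurable C -> cond_indep_on P U V W D ->
  measurable_fun setT h -> (forall z, 0 <= h z)%R ->
  \int[P]_w (h (U w, W w) * (\1_D (W w) * \1_C (V w)))%:E =
  \int[P]_w (h (U w, W w) * (\1_D (W w) * condprob0 P W (V @^-1` C) (W w)))%:E.
Proof.
move=> mD mC UV mh h0.
have mp S (TS : measurableType S) (F : T -> TS) B : measurable_fun setT F ->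
    measurable B -> measurable (F @^-1` B).
  by move=> mF mB; rewrite -[X in measurable X]setTI; exact: mF.
have mVC := mp _ _ _ _ mV mC.
have m0 := measurable_condprob0 P mW mVC.
have m0W : measurable_fun setT (fun w => condprob0 P W (V @^-1` C) (W w)).
  exact: measurableT_comp.
have m1 S (TS : measurableType S) (F : T -> TS) B : measurable_fun setT F ->
    measurable B -> measurable_fun setT (fun w => \1_B (F w) : R).
  by move=> mF mB; apply: measurableT_comp => //; exact: measurable_indic.
have mu : measurable_fun setT (fun w => \1_D (W w) * \1_C (V w) : R)%R.
  by apply: measurable_funM; exact: m1.
have mv : measurable_fun setT
    (fun w => \1_D (W w) * condprob0 P W (V @^-1` C) (W w) : R)%R.
  by apply: measurable_funM => //; exact: m1.
have mUW : measurable_fun setT (fun w => (U w, W w)) by exact: measurable_fun_pair.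
apply: (@ge0_eq_integral_comp _ _ _ _ _ _ (fun w => (U w, W w))) => //.
- by move=> w; rewrite mulr_ge0// condexp0_ge0.
move=> B mB; rewrite !integral_indic_preimage; move: B mB.
apply: eq_integral_prod => //.
- rewrite (_ : EFin \o _ = fun w => (\1_(W @^-1` D `&` V @^-1` C) w)%:E).
    by apply: integrable_indic1; apply: measurableI; exact: mp.
  by apply/funext => w /=; rewrite indicI.
- apply: le_integrable (integrable_condprob0 P mW mVC) => //.
    exact/measurable_EFinP.
  move=> w _ /=; rewrite lee_fin normrM ler_piMl// indicE.
  by case: (_ \in _); rewrite ?normr1 ?normr0.
move=> B D' mB mD'.
set A := D' `&` D; have mA : measurable A by exact: measurableI.
have mUB := mp _ _ _ _ mU mB.
have mI : measurable (U @^-1` B `&` V @^-1` C) by exact: measurableI.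
have preE S (TS : measurableType S) (F : T -> TS) (G : set TS) w :
  \1_(F @^-1` G) w = \1_G (F w) :> R by [].
have mA1 : measurable_fun setT (\1_A : TW -> R) by exact: measurable_indic.
transitivity (\int[P]_w (\1_A (W w) * \1_(U @^-1` B `&` V @^-1` C) w)%:E).
  rewrite -integral_indicM; apply: eq_integral => w _.
  by rewrite !indicI/= !preE [X in (X * _)%R]mulrC mulrACA.
have A0 z : (0 <= \1_A z :> R)%R by [].
have E1 := ge0_integral_condprob0 P mW mI mA1 A0.
etransitivity; first exact: E1.
transitivity (\int[P]_w ((\1_A (W w) * condprob0 P W (V @^-1` C) (W w)) *
    condprob0 P W (U @^-1` B) (W w))%:E).
  apply: ge0_ae_eq_integral => //.
  - apply/measurable_EFinP; apply: measurable_funM; first exact: m1.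
    by apply: measurableT_comp => //; exact: measurable_condprob0.
  - apply/measurable_EFinP; apply: measurable_funM => /=.
      by apply: measurable_funM => //; exact: m1.
    by apply: measurableT_comp => //; exact: measurable_condprob0.
  - by move=> w _; rewrite lee_fin mulr_ge0// condexp0_ge0.
  - by move=> w _; rewrite lee_fin !mulr_ge0// condexp0_ge0.
  - apply: filterS3 (filterI (condprob0_ae P mW mVC) (condprob0_ae P mW mUB))
      (condprob0_ae P mW mI) (UV _ _ mB mC) => w [e1 e2] e3 e _; congr EFin.
    rewrite (indicE R A (W w)); case: (boolP (W w \in A)); rewrite ?mul0r// !mul1r.
    rewrite inE => -[_ /e]; rewrite e1 e2 e3 => ->.
    by rewrite mulrC.
(* The remaining factor is a nonnegative function of W, so P(U in B | W) can be turned back into the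
   indicator of {U in B}. *)
have mk : measurable_fun setT (fun z => \1_A z * condprob0 P W (V @^-1` C) z)%R.
  exact: measurable_funM.
have k0 z : (0 <= \1_A z * condprob0 P W (V @^-1` C) z)%R.
  by rewrite mulr_ge0// condexp0_ge0.
have E2 := ge0_integral_condprob0 P mW mUB mk k0.
etransitivity; first exact: (esym E2).
rewrite -[RHS]integral_indicM; apply: eq_integral => w _; congr EFin.
rewrite !indicI/= !preE; move: (\1_B _) (condprob0 _ _ _ _) (\1_D _) (\1_D' _).
by move=> x1 x2 x3 x4; ring.
Qed.

Lemma cond_indep_integral (C : set TV) (h : TU * TW -> R) :
  measurable C -> cond_indep P U V W ->
  measurable_fun setT h -> (forall z, 0 <= h z)%R ->
  \int[P]_w (h (U w, W w) * \1_C (V w))%:E =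
  \int[P]_w (h (U w, W w) * condprob0 P W (V @^-1` C) (W w))%:E.
Proof.
move=> mC UV mh h0.
have := cond_indep_on_integral measurableT mC UV mh h0.
under eq_integral do rewrite indicT mul1r.
by under [X in _ = X -> _]eq_integral do rewrite indicT mul1r.
Qed.

End conditional_independence.

(** Being a version depends only on the joint law of (W, Z). The two sets of versions coincide, so
    [xget] selects the same function, and the equality holds everywhere rather than almost
    everywhere. *)
Lemma same_law_condexp d (T : measurableType d) d' (T' : measurableType d')
    (R : realType) (P : probability T R) (P' : probability T' R)
    dW (TW : measurableType dW) (W : T -> TW) (W' : T' -> TW)
    (Z : T -> R) (Z' : T' -> R) :
  measurable_fun setT W -> measurable_fun setT W' ->
  measurable_fun setT Z -> measurable_fun setT Z' ->
  (forall B : set (TW * R), measurable B ->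
    P ((fun w => (W w, Z w)) @^-1` B) = P' ((fun w => (W' w, Z' w)) @^-1` B)) ->
  P.-integrable setT (fun w => (Z w)%:E) ->
  P'.-integrable setT (fun w => (Z' w)%:E) ->
  condexp P W Z = condexp P' W' Z'.
Proof.
move=> mW mW' mZ mZ' PP' iZ iZ'; rewrite /condexp; congr xget.
have mWZ : measurable_fun setT (fun w => (W w, Z w)) by exact: measurable_fun_pair.
have mWZ' : measurable_fun setT (fun w => (W' w, Z' w)) by exact: measurable_fun_pair.
have ge0E (k : TW * R -> \bar R) : measurable_fun setT k -> (forall z, 0 <= k z) ->
    \int[P]_w k (W w, Z w) = \int[P']_w k (W' w, Z' w).
  move=> mk k0.
  rewrite -[LHS](@ge0_integral_pushforward _ _ _ _ _ _ mWZ P setT k)//.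
  rewrite -[RHS](@ge0_integral_pushforward _ _ _ _ _ _ mWZ' P' setT k)//.
  by apply: eq_measure_integral => B mB _; exact: PP'.
have intE (k : TW * R -> \bar R) : measurable_fun setT k ->
    \int[P]_w k (W w, Z w) = \int[P']_w k (W' w, Z' w).
  move=> mk; rewrite [LHS]integralE [RHS]integralE; congr (_ - _).
  - have := ge0E k^\+ (measurable_funepos mk) (funepos_ge0 _).
    rewrite -[X in X = _]/(\int[P]_w (k^\+ \o (fun w => (W w, Z w))) w).
    rewrite -[X in _ = X]/(\int[P']_w (k^\+ \o (fun w => (W' w, Z' w))) w).
    by rewrite -!funepos_comp.
  - have := ge0E k^\- (measurable_funeneg mk) (funeneg_ge0 _).
    rewrite -[X in X = _]/(\int[P]_w (k^\- \o (fun w => (W w, Z w))) w).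
    rewrite -[X in _ = X]/(\int[P']_w (k^\- \o (fun w => (W' w, Z' w))) w).
    by rewrite -!funeneg_comp.
have setE (B : set TW) (k : TW * R -> R) : measurable B -> measurable_fun setT k ->
    \int[P]_(w in W @^-1` B) (k (W w, Z w))%:E =
    \int[P']_(w in W' @^-1` B) (k (W' w, Z' w))%:E.
  move=> mB mk; rewrite -!integral_indic_preimage.
  apply: (intE (fun z => (\1_B z.1 * k z)%:E)).
  apply/measurable_EFinP; apply: measurable_funM => //.
  by apply: (measurableT_comp (f := \1_B : TW -> R)); [exact: measurable_indic|].
apply/seteqP; split => g [mg [ig Ig]]; split => //.
- apply/integrableP; split.
    by apply/measurable_EFinP; exact: measurableT_comp.
  case/integrableP: ig => _; apply: le_lt_trans.
  rewrite (intE (fun z => `|(g z.1)%:E|))//.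
  by do 2 apply: measurableT_comp => //; exact: measurableT_comp.
- move=> B mB; rewrite -(setE B (fun z => g z.1))//; last exact: measurableT_comp.
  by rewrite -(setE B snd)// Ig.
- apply/integrableP; split.
    by apply/measurable_EFinP; exact: measurableT_comp.
  case/integrableP: ig => _; apply: le_lt_trans.
  rewrite (intE (fun z => `|(g z.1)%:E|))//.
  by do 2 apply: measurableT_comp => //; exact: measurableT_comp.
- move=> B mB; rewrite (setE B (fun z => g z.1))//; last exact: measurableT_comp.
  by rewrite (setE B snd)// Ig.
Qed.

(** * Boolean events, sections and inverses *)

Lemma indic_set1 (R : realType) (a b : bool) : \1_[set a] b = (b == a)%:R :> R.
Proof.
by rewrite indicE; congr (nat_of_bool _)%:R; apply/idP/eqP; rewrite inE.
Qed.

Lemma indic_eq_event (R : realType) (T : Type) (V : T -> bool) (a : bool) (w : T) :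
  \1_[set w | V w = a] w = (V w == a)%:R :> R.
Proof. exact: indic_set1. Qed.

Lemma measurable_eqbR d (T : measurableType d) (R : realType) (V : T -> bool)
    (a : bool) :
  measurable_fun setT V -> measurable_fun setT (fun w => (V w == a)%:R : R).
Proof.
move=> mV; apply: (measurableT_comp (f := fun b : bool => (b == a)%:R : R)) => //.
Qed.

(** On nonnegative reals the inverse is the power with exponent -1, also at 0, where both are 0. *)
Lemma measurable_invr d (T : measurableType d) (R : realType) (f : T -> R) :
  (forall w, 0 <= f w)%R -> measurable_fun setT f ->
  measurable_fun setT (fun w => (f w)^-1)%R.
Proof.
move=> f0 mf.
rewrite (_ : (fun w => _) = (@powR R ^~ (-1)%R) \o f).
  by apply: measurableT_comp => //; exact: measurable_powR.
by apply/funext => w /=; rewrite powR_inv1.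
Qed.

Lemma measurable_section1 d1 d2 d3 (T1 : measurableType d1)
    (T2 : measurableType d2) (T3 : measurableType d3) (g : T1 * T2 -> T3) (a : T1) :
  measurable_fun setT g -> measurable_fun setT (fun x => g (a, x)).
Proof.
move=> mg; apply: (measurableT_comp (f := g) (g := pair a)) => //.
Qed.

Lemma measurable_section_mid d1 d2 d3 d4 (T1 : measurableType d1)
    (T2 : measurableType d2) (T3 : measurableType d3) (T4 : measurableType d4)
    (g : T1 * T2 * T3 -> T4) (a : T1) (c : T3) :
  measurable_fun setT g -> measurable_fun setT (fun x => g (a, x, c)).
Proof.
move=> mg; apply: (measurableT_comp (f := g) (g := fun x => (a, x, c))) => //.
by apply: measurable_fun_pair => //; exact: measurable_fun_pair.
Qed.

Section bool_versions.
Context d (T : measurableType d) (R : realType) (P : probability T R).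
Context dU (TU : measurableType dU) dW (TW : measurableType dW).
Variables (U : T -> TU) (V : T -> bool) (W : T -> TW).
Hypotheses (mU : measurable_fun setT U) (mV : measurable_fun setT V)
  (mW : measurable_fun setT W).

Lemma measurable_bool_event (a : bool) : measurable [set w | V w = a].
Proof.
rewrite (_ : [set w | _] = V @^-1` [set a])// -[X in measurable X]setTI.
exact: mV.
Qed.

Lemma measurable_condprob0_bool (a : bool) :
  measurable_fun setT (condprob0 P W [set w | V w = a]).
Proof. exact/measurable_condprob0/measurable_bool_event. Qed.

Lemma condprob0_integral_bool (a : bool) (h : TW -> R) :
  measurable_fun setT h -> (forall z, 0 <= h z)%R ->
  \int[P]_w (h (W w) * (V w == a)%:R)%:E =
  \int[P]_w (h (W w) * condprob0 P W [set w | V w = a] (W w))%:E.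
Proof.
move=> mh h0; rewrite -ge0_integral_condprob0//; last exact: measurable_bool_event.
by apply: eq_integral => w _; rewrite indic_eq_event.
Qed.

Lemma cond_indep_integral_bool (a : bool) (h : TU * TW -> R) :
  cond_indep P U V W -> measurable_fun setT h -> (forall z, 0 <= h z)%R ->
  \int[P]_w (h (U w, W w) * (V w == a)%:R)%:E =
  \int[P]_w (h (U w, W w) * condprob0 P W [set w | V w = a] (W w))%:E.
Proof.
move=> UV mh h0.
have := @cond_indep_integral _ _ _ P _ _ _ _ _ _ U V W mU mV mW [set a] h.
move=> /(_ _ UV mh h0) <- //.
by apply: eq_integral => w _; rewrite indic_set1.
Qed.

Lemma cond_indep_on_integral_bool (p : TW -> bool) (a c : bool) (h : TU * TW -> R) :
  measurable_fun setT p -> cond_indep_on P U V W [set z | p z = a] ->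
  measurable_fun setT h -> (forall z, 0 <= h z)%R ->
  \int[P]_w (h (U w, W w) * ((p (W w) == a)%:R * (V w == c)%:R))%:E =
  \int[P]_w (h (U w, W w) *
    ((p (W w) == a)%:R * condprob0 P W [set w | V w = c] (W w)))%:E.
Proof.
move=> mp UV mh h0.
have mD : measurable [set z | p z = a].
  rewrite (_ : [set z | _] = p @^-1` [set a])// -[X in measurable X]setTI.
  exact: mp.
have := @cond_indep_on_integral _ _ _ P _ _ _ _ _ _ U V W mU mV mW
  [set z | p z = a] [set c] h mD.
move=> /(_ _ UV mh h0) => /(_ I).
under eq_integral do rewrite (indic_eq_event _ p) indic_set1.
by under [X in _ = X -> _]eq_integral do rewrite (indic_eq_event _ p).
Qed.

End bool_versions.

(** * Almost everywhere equality and restricted measures *)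

Lemma ae_eq_integralR d (T : measurableType d) (R : realType)
    (mu : {measure set T -> \bar R}) (f g : T -> R) :
  measurable_fun setT f -> measurable_fun setT g ->
  {ae mu, forall w, f w = g w} ->
  \int[mu]_w (f w)%:E = \int[mu]_w (g w)%:E.
Proof.
move=> mf mg fg; apply: ae_eq_integral => //; try exact/measurable_EFinP.
by apply: filterS fg => w ->.
Qed.

Lemma ge0_integral_eq0_ae d (T : measurableType d) (R : realType)
    (mu : {measure set T -> \bar R}) (f : T -> R) :
  measurable_fun setT f -> (forall w, 0 <= f w)%R ->
  \int[mu]_w (f w)%:E = 0 -> {ae mu, forall w, f w = 0%R}.
Proof.
move=> mf f0 I0; have mf' : measurable_fun setT (EFin \o f) by exact/measurable_EFinP.
have : ae_eq mu setT (EFin \o f) (cst 0).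
  apply/ae_eq_integral_abs => //.
  by rewrite -[RHS]I0; apply: eq_integral => w _ /=; rewrite ger0_norm.
by apply: filterS => w /(_ Logic.I) [].
Qed.

(** P is the sum of its restrictions to E and to the complement. For the first, f and f 1_E agree
    almost everywhere; for the second, f 1_E vanishes almost everywhere. *)
Lemma ge0_integral_mrestr d (T : measurableType d) (R : realType)
    (P : {measure set T -> \bar R}) (E : set T) (mE : measurable E) (f : T -> R) :
  measurable_fun setT f -> (forall w, 0 <= f w)%R ->
  \int[mrestr P mE]_w (f w)%:E = \int[P]_w (f w * \1_E w)%:E.
Proof.
move=> mf f0; have mCE := measurableC mE.
have mfE : measurable_fun setT (fun w => f w * \1_E w)%R.
  by apply: measurable_funM => //; exact: measurable_indic.
transitivity (\int[mrestr P mE]_w (f w * \1_E w)%:E).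
  apply: ae_eq_integralR => //; exists (~` E); split => //.
    by rewrite /= /mrestr /= setICl measure0.
  move=> w /= h Ew; apply: h; by rewrite indicE mem_set// mulr1.
have z : \int[mrestr P mCE]_w (f w * \1_E w)%:E = 0.
  rewrite -[RHS](integral0 (mrestr P mCE) setT); apply: ae_eq_integralR => //.
  exists E; split => //; first by rewrite /= /mrestr /= setICr measure0.
  move=> w /= h; apply: contrapT => Ew; apply: h.
  by rewrite indicE memNset// mulr0.
rewrite -[LHS]adde0 -z -ge0_integral_measure_add//; last 2 first.
- by move=> w _; rewrite lee_fin mulr_ge0.
- exact/measurable_EFinP.
apply: eq_measure_integral => B mB _.
rewrite [LHS](measure_addE _ _ B) /= /mrestr -measureU//; last 3 first.
- exact: measurableI.
- exact: measurableI.
- by rewrite setIACA setICr setI0.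
by rewrite -setIUr setUv setIT.
Qed.

Lemma eqe_pmul2l (R : realDomainType) (x y z : \bar R) :
  x \is a fin_num -> 0 < x -> x * y = x * z -> y = z.
Proof.
by move=> fx x0 /eqP; rewrite eq_le !lee_pmul2l// -eq_le => /eqP.
Qed.

(** * Identification *)

Section identification.
Context (R : realType) (dX : measure_display) (TX : measurableType dX)
  (V : setting R TX).
Hypothesis hV : assumptions V.

Local Notation P := (Pr V).
Local Notation X := (covX V : Omega V -> TX).
Local Notation A := (expA V : Omega V -> bool).
Local Notation M := (medM V : Omega V -> bool).
Local Notation Y := (outY V : Omega V -> R).
Local Notation S := (mrkS V : Omega V -> bool).
Local Notation N a m := (potY V a m : Omega V -> R).
Local Notation Mp a := (potM V a : Omega V -> bool).

Let mX : measurable_fun setT X. Proof. exact: measurable_funPT. Qed.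
Let mA : measurable_fun setT A. Proof. exact: measurable_funPT. Qed.
Let mM : measurable_fun setT M. Proof. exact: measurable_funPT. Qed.
Let mY : measurable_fun setT Y. Proof. exact: measurable_funPT. Qed.
Let mS : measurable_fun setT S. Proof. exact: measurable_funPT. Qed.
Let mN a m : measurable_fun setT (N a m). Proof. exact: measurable_funPT. Qed.
Let mMp a : measurable_fun setT (Mp a). Proof. exact: measurable_funPT. Qed.

Let mXS : measurable_fun setT (fun w => (X w, S w)).
Proof. exact: measurable_fun_pair. Qed.
Let mSX : measurable_fun setT (fun w => (S w, X w)).
Proof. exact: measurable_fun_pair. Qed.
Let mAX : measurable_fun setT (fun w => (A w, X w)).
Proof. exact: measurable_fun_pair. Qed.
Let mAXS : measurable_fun setT (fun w => (A w, X w, S w)).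
Proof. exact: measurable_fun_pair. Qed.
Let mAMX : measurable_fun setT (fun w => (A w, M w, X w)).
Proof. by apply: measurable_fun_pair => //; exact: measurable_fun_pair. Qed.
Let mNMp a m : measurable_fun setT (fun w => (N a m w, Mp a w)).
Proof. exact: measurable_fun_pair. Qed.

(** * Nonnegative versions and integrated forms of the assumptions *)

Definition propensity0 (a : bool) : TX -> R := condprob0 P X [set w | A w = a].

Definition pM0 (m a : bool) (x : TX) : R :=
  condprob0 P (fun w => (A w, X w)) [set w | M w = m] (a, x).

Lemma propensity0_ge0 a x : (0 <= propensity0 a x)%R. Proof. exact: condexp0_ge0. Qed.

Lemma pM0_ge0 m a x : (0 <= pM0 m a x)%R. Proof. exact: condexp0_ge0. Qed.

Lemma measurable_propensity0 a : measurable_fun setT (propensity0 a).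
Proof. exact: measurable_condprob0_bool. Qed.

Lemma measurable_pM0 m a : measurable_fun setT (pM0 m a).
Proof.
apply: (measurable_section1 (g := condprob0 P (fun w => (A w, X w))
  [set w | M w = m])).
exact: measurable_condprob0_bool.
Qed.

Lemma propensity0_gt0 a : {ae P, forall w, (0 < propensity0 a (X w))%R}.
Proof.
have /ae_distribution := a_positivity hV.
apply: filterS => w /(_ a true) [+ _].
by rewrite /propensity /propensity0 /condprob0 /condexp0 => h; rewrite lt_max [X in _ || X]h orbT.
Qed.

Lemma pM_gt0 m a : {ae P, forall w, (0 < pM V m a (X w))%R}.
Proof. by have /ae_distribution := a_positivity hV; apply: filterS => w /(_ a m) []. Qed.

(** Uniqueness of versions compares them at (A w, X w), which says nothing about (a, X w) when A w
    differs from a. Positivity does: the chosen version is positive at (a, X), so truncating it at 0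
    changes nothing. *)
Lemma pM0_pM m a : {ae P, forall w, pM0 m a (X w) = pM V m a (X w)}.
Proof.
apply: filterS (pM_gt0 m a) => w h.
by rewrite /pM0 /condprob0 /condexp0 max_r// ltW.
Qed.

Lemma consistencyP a : {ae P, forall w, A w = a ->
  M w = Mp a w /\ Y w = N a (M w) w}.
Proof.
by apply: filterS (a_consistency hV) => w /(_ a) h /h[-> /(_ _ erefl)].
Qed.

Lemma blinding_integral a (h : bool * TX -> R) :
  measurable_fun setT h -> (forall z, 0 <= h z)%R ->
  \int[P]_w (h (S w, X w) * (A w == a)%:R)%:E =
  \int[P]_w (h (S w, X w) * propensity0 a (X w))%:E.
Proof. by move=> mh h0; apply: cond_indep_integral_bool => //; exact: a_blinding hV. Qed.

Lemma ignorability_integral a m (h : R * bool * TX -> R) :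
  measurable_fun setT h -> (forall z, 0 <= h z)%R ->
  \int[P]_w (h (N a m w, Mp a w, X w) * (A w == a)%:R)%:E =
  \int[P]_w (h (N a m w, Mp a w, X w) * propensity0 a (X w))%:E.
Proof.
move=> mh h0; have [UV _] := a_ignorability hV a m.
exact: (cond_indep_integral_bool (mNMp a m) mA mX _ UV mh h0).
Qed.

Lemma propensity_integral a (h : TX -> R) :
  measurable_fun setT h -> (forall z, 0 <= h z)%R ->
  \int[P]_w (h (X w) * (A w == a)%:R)%:E = \int[P]_w (h (X w) * propensity0 a (X w))%:E.
Proof. by move=> mh h0; exact: condprob0_integral_bool. Qed.

Lemma mediator_integral m a (h : TX -> R) :
  measurable_fun setT h -> (forall z, 0 <= h z)%R ->
  \int[P]_w (h (X w) * ((A w == a)%:R * (M w == m)%:R))%:E =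
  \int[P]_w (h (X w) * pM0 m a (X w) * (A w == a)%:R)%:E.
Proof.
move=> mh h0.
(* The indicator of {A = a} is put into the test function, so that the conditional probability given
   (A, X) is read at (a, X). *)
pose k (z : bool * TX) : R := (h z.2 * (z.1 == a)%:R)%R.
have mk : measurable_fun setT k.
  apply: measurable_funM; first exact: (measurableT_comp mh measurable_snd).
  by apply: measurable_eqbR; exact: measurable_fst.
have k0 z : (0 <= k z)%R by rewrite mulr_ge0.
have E := condprob0_integral_bool P mM mAX m mk k0.
transitivity (\int[P]_w (k (A w, X w) * (M w == m)%:R)%:E).
  by apply: eq_integral => w _; rewrite /k /= mulrA.
rewrite E; apply: eq_integral => w _; congr EFin; rewrite /k /= /pM0.
by have [->|] := eqVneq (A w) a; rewrite ?(mulr1, mulr0, mul0r).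
Qed.

(** Inverse propensity weighting: after division by the propensity, ignorability inserts 1{A = a},
    consistency replaces M(a) by M, conditioning on (A, X) produces P(M = m | A = a, X), and
    averaging A out cancels the weight. This is P(M(a) = m | X) = P(M = m | A = a, X) in integrated
    form. *)
Lemma potM_integral m a (f : TX -> R) :
  measurable_fun setT f -> (forall z, 0 <= f z)%R ->
  \int[P]_w (f (X w) * (Mp a w == m)%:R)%:E =
  \int[P]_w (f (X w) * pM0 m a (X w))%:E.
Proof.
move=> mf f0.
have mi : measurable_fun setT (fun x => (propensity0 a x)^-1)%R.
  by apply: measurable_invr; [exact: propensity0_ge0|exact: measurable_propensity0].
have mfi : measurable_fun setT (fun x => f x * (propensity0 a x)^-1)%R by exact: measurable_funM.
have fi0 x : (0 <= f x * (propensity0 a x)^-1)%R by rewrite mulr_ge0// invr_ge0 propensity0_ge0.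
have mfX (g : TX -> R) : measurable_fun setT g -> measurable_fun setT (fun w => g (X w)).
  by move=> mg; exact: measurableT_comp.
pose k (z : R * bool * TX) : R := (f z.2 * (propensity0 a z.2)^-1 * (z.1.2 == m)%:R)%R.
have mk : measurable_fun setT k.
  apply: measurable_funM; first exact: (measurableT_comp mfi measurable_snd).
  apply: measurable_eqbR; exact: (measurableT_comp measurable_snd measurable_fst).
have k0 z : (0 <= k z)%R by rewrite mulr_ge0.
have m1 b : measurable_fun setT (fun w => (Mp b w == m)%:R : R) by exact: measurable_eqbR.
have m2 : measurable_fun setT (fun w => (M w == m)%:R : R) by exact: measurable_eqbR.
have m3 : measurable_fun setT (fun w => (A w == a)%:R : R) by exact: measurable_eqbR.
transitivity (\int[P]_w (k (N a m w, Mp a w, X w) * propensity0 a (X w))%:E).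
  apply: ae_eq_integralR.
  - by apply: measurable_funM => //; exact: mfX.
  - apply: measurable_funM; last exact/mfX/measurable_propensity0.
    by apply: measurable_funM; [exact: (mfX _ mfi)|exact: m1].
  - apply: filterS (propensity0_gt0 a) => w e1; rewrite /k /=.
    by rewrite mulrAC divfK// gt_eqF.
rewrite -ignorability_integral//.
transitivity (\int[P]_w (f (X w) * (propensity0 a (X w))^-1 *
    ((A w == a)%:R * (M w == m)%:R))%:E).
  apply: ae_eq_integralR.
  - apply: measurable_funM => //.
    by apply: measurable_funM; [exact: (mfX _ mfi)|exact: m1].
  - apply: measurable_funM; first exact: (mfX _ mfi).
    exact: measurable_funM.
  - apply: filterS (consistencyP a) => w; rewrite /k /=.
    have [-> /(_ erefl)[-> _]|] := eqVneq (A w) a.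
      by rewrite mulr1 mul1r.
    by rewrite mul0r !mulr0.
have E := mediator_integral m a mfi fi0; rewrite E {E}.
have mp := measurable_pM0 m a.
have mfip : measurable_fun setT (fun x => f x * (propensity0 a x)^-1 * pM0 m a x)%R.
  exact: measurable_funM.
have fip0 x : (0 <= f x * (propensity0 a x)^-1 * pM0 m a x)%R by rewrite mulr_ge0// pM0_ge0.
have E := propensity_integral a mfip fip0; rewrite E {E}.
apply: ae_eq_integralR.
- by apply: measurable_funM; [exact: (mfX _ mfip)|exact/mfX/measurable_propensity0].
- by apply: measurable_funM; exact: mfX.
- apply: filterS (propensity0_gt0 a) => w e1.
  by rewrite mulrAC divfK// gt_eqF.
Qed.

(* Inverse weighting: the hypothesis is applied to h(n, x) = n / rho(x) and, in
   the reverse direction, to h(n, x) = muY a m x / rho(x). The events G of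
   interest are {M(a) = m} and {S_M = m}. *)
Lemma event_transfer a m (G : Omega V -> bool) (rho t : TX -> R) :
  measurable_fun setT G -> measurable_fun setT rho -> (forall x, 0 <= rho x)%R ->
  measurable_fun setT t -> (forall x, 0 <= t x)%R ->
  (forall h : R * TX -> R, measurable_fun setT h -> (forall z, 0 <= h z)%R ->
    \int[P]_w (h (N a m w, X w) * ((G w)%:R * rho (X w)))%:E =
    \int[P]_w (h (Y w, X w) * ((A w == a)%:R * (M w == m)%:R * t (X w)))%:E) ->
  {ae P, forall w, G w -> (0 < rho (X w))%R} ->
  P.-integrable setT (fun w => (Y w)%:E) ->
  P.-integrable setT (fun w => (N a m w * (G w)%:R)%:E) ->
  P.-integrable setT (fun w => (muY V a m (X w) * (G w)%:R)%:E) /\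
  \int[P]_w (muY V a m (X w) * (G w)%:R)%:E = \int[P]_w (N a m w * (G w)%:R)%:E.
Proof.
move=> mG mrho rho0 mt t0 H rhoG iY iN.
have cY := condexpP mAMX iY.
have mmu : measurable_fun setT (muY V a m).
  by have [mc _ _] := cY; exact: (measurable_section1 (a, m) mc).
have mi : measurable_fun setT (fun x => (rho x)^-1)%R by exact: measurable_invr.
have mGR : measurable_fun setT (fun w => (G w)%:R : R).
  rewrite (_ : (fun w => _) = fun w => (G w == true)%:R); first exact: measurable_eqbR.
  by apply/funext => w; case: (G w).
have mAM : measurable_fun setT (fun w => (A w == a)%:R * (M w == m)%:R : R)%R.
  by apply: measurable_funM; exact: measurable_eqbR.
have mX' (g : TX -> R) : measurable_fun setT g -> measurable_fun setT (fun w => g (X w)).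
  by move=> mg; exact: measurableT_comp.
have mu_ : measurable_fun setT (fun w => (G w)%:R * rho (X w))%R.
  by apply: measurable_funM => //; exact: mX'.
have mv : measurable_fun setT (fun w => (A w == a)%:R * (M w == m)%:R * t (X w))%R.
  by apply: measurable_funM => //; exact: mX'.
have u0 w : (0 <= (G w)%:R * rho (X w))%R by rewrite mulr_ge0.
have v0 w : (0 <= (A w == a)%:R * (M w == m)%:R * t (X w))%R by rewrite !mulr_ge0.
have mNX : measurable_fun setT (fun w => (N a m w, X w)) by exact: measurable_fun_pair.
have mYX : measurable_fun setT (fun w => (Y w, X w)) by exact: measurable_fun_pair.
pose h1 (z : R * TX) : R := (z.1 * (rho z.2)^-1)%R.
pose h2 (z : R * TX) : R := (muY V a m z.2 * (rho z.2)^-1)%R.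
have mh1 : measurable_fun setT h1.
  apply: measurable_funM; first exact: measurable_fst.
  exact: (measurableT_comp mi measurable_snd).
have mh2 : measurable_fun setT h2.
  apply: measurable_funM; first exact: (measurableT_comp mmu measurable_snd).
  exact: (measurableT_comp mi measurable_snd).
have e1 : {ae P, forall w,
    (N a m w * (G w)%:R = h1 (N a m w, X w) * ((G w)%:R * rho (X w)))%R}.
  apply: filterS rhoG => w; rewrite /h1 /=; case: (G w) => [/(_ isT) r0|_].
    by rewrite mulr1 mul1r divfK// gt_eqF.
  by rewrite mul0r !mulr0.
have e2 : {ae P, forall w,
    (h2 (N a m w, X w) * ((G w)%:R * rho (X w)) = muY V a m (X w) * (G w)%:R)%R}.
  apply: filterS rhoG => w; rewrite /h2 /=; case: (G w) => [/(_ isT) r0|_].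
    by rewrite mulr1 mul1r divfK// gt_eqF.
  by rewrite mul0r !mulr0.
have mh1u : measurable_fun setT (fun w => h1 (N a m w, X w) * ((G w)%:R * rho (X w)))%R.
  by apply: measurable_funM => //; exact: (measurableT_comp mh1 mNX).
have mh2u : measurable_fun setT (fun w => h2 (N a m w, X w) * ((G w)%:R * rho (X w)))%R.
  by apply: measurable_funM => //; exact: (measurableT_comp mh2 mNX).
have i1 := ae_integrable mh1u e1 iN.
have [i2 E2] := eq_integral_comp_signed mYX u0 mv v0 H mh1 i1.
(* All weights are functions of (A, M, X), hence can be pulled out when Y is replaced by its
   regression. *)
pose f (z : bool * bool * TX) : R :=
  ((z.1.1 == a)%:R * (z.1.2 == m)%:R * t z.2 * (rho z.2)^-1)%R.
have mf : measurable_fun setT f.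
  apply: measurable_funM; last exact: (measurableT_comp mi measurable_snd).
  apply: measurable_funM; last exact: (measurableT_comp mt measurable_snd).
  apply: measurable_funM; apply: measurable_eqbR.
    exact: (measurableT_comp measurable_fst measurable_fst).
  exact: (measurableT_comp measurable_snd measurable_fst).
have f0 z : (0 <= f z)%R by rewrite !mulr_ge0// invr_ge0.
have fE : (fun w => (h1 (Y w, X w) * ((A w == a)%:R * (M w == m)%:R * t (X w)))%:E) =
    (fun w => (f (A w, M w, X w) * Y w)%:E).
  apply/funext => w; rewrite /h1 /f /=; congr EFin.
  move: (_ == a)%:R (_ == m)%:R (t _) (rho _)^-1%R (Y w) => x1 x2 x3 x4 x5; ring.
have i3 : P.-integrable setT (fun w => (f (A w, M w, X w) * Y w)%:E) by rewrite -fE.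
have [i4 E4] := integral_condexpM mAMX iY cY mf f0 i3.
(* The indicators in the weight force A = a and M = m, so the regression at (A, M, X) becomes
   [muY V a m]. *)
have gE : (fun w => (f (A w, M w, X w) *
    condexp P (fun w => (A w, M w, X w)) Y (A w, M w, X w))%:E) =
    (fun w => (h2 (Y w, X w) * ((A w == a)%:R * (M w == m)%:R * t (X w)))%:E).
  apply/funext => w; rewrite /h2 /f /muY /=; congr EFin.
  have [->|] := eqVneq (A w) a; last by rewrite !(mul0r, mulr0).
  have [->|] := eqVneq (M w) m; last by rewrite !(mul0r, mulr0).
  move: (t _) (rho _)^-1%R (condexp _ _ _ _) => x1 x2 x3; ring.
have i5 : P.-integrable setT
    (fun w => (h2 (Y w, X w) * ((A w == a)%:R * (M w == m)%:R * t (X w)))%:E).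
  by rewrite -gE.
(* [h2] does not look at the outcome coordinate, so the identity read backwards returns to G with
   the regression in place of the potential outcome. *)
have H' (h : R * TX -> R) (mh : measurable_fun setT h) (h0 : (forall z, 0 <= h z)%R) :=
  esym (H h mh h0).
have [i6 E6] := eq_integral_comp_signed mNX v0 mu_ u0 H' mh2 i5.
have mmuG : measurable_fun setT (fun w => muY V a m (X w) * (G w)%:R)%R.
  by apply: measurable_funM => //; exact: mX'.
split; first exact: ae_integrable e2 i6.
rewrite -(ae_eq_integralR mh2u mmuG e2) -E6 -gE E4 -fE -E2.
apply/esym/ae_eq_integralR => //.
exact: measurable_funM.
Qed.

(** * The marker as the potential mediator M(b) *)

Lemma measurable_potM_event b : measurable [set w | Mp b w = true].
Proof. exact: measurable_bool_event. Qed.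

Lemma marker_response_integral b s p : marker_response V b s p ->
  \int[P]_w ((S w == s)%:R * (Mp b w == true)%:R)%:E =
  \int[P]_w ((S w == s)%:R * p)%:E.
Proof.
move=> Hp.
pose k (z : bool * TX) : R := (z.1 == s)%:R.
have mk : measurable_fun setT k by apply: measurable_eqbR; exact: measurable_fst.
have E := condprob0_integral_bool P (mMp b) mSX true mk (fun z => ler0n _ _).
etransitivity; first exact: E.
apply: ae_eq_integralR.
- apply: measurable_funM; first exact: measurable_eqbR.
  by apply: measurableT_comp => //; exact: measurable_condprob0_bool.
- by apply: measurable_funM => //; exact: measurable_eqbR.
- apply: filterS2 Hp (condprob0_ae P mSX (measurable_potM_event b)) => w e <-.
  rewrite /k /=; have [Ss|] := eqVneq (S w) s; last by rewrite !mul0r.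
  by rewrite -[in RHS](e Ss) Ss.
Qed.

Lemma necessity_ae b : {ae P, forall w, S w = false -> Mp b w = false}.
Proof.
have := marker_response_integral (a_necessity hV b).
under [RHS]eq_integral do rewrite mulr0.
rewrite integral0 => /ge0_integral_eq0_ae H.
have : {ae P, forall w, ((S w == false)%:R * (Mp b w == true)%:R = 0 :> R)%R}.
  apply: H; last by move=> w; rewrite mulr_ge0.
  by apply: measurable_funM; exact: measurable_eqbR.
apply: filterS => w + Sw; rewrite Sw mul1r; case: (Mp b w) => //= /eqP.
by rewrite oner_eq0.
Qed.

(** Sufficiency gives P(S_M = 1, M(b) = 1) = P(S_M = 1), so {S_M = 1, M(b) = 0} is null; necessity
    settles S_M = 0. *)
Lemma sufficiency_ae b : marker_response V b true 1%R ->
  {ae P, forall w, Mp b w = S w}.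
Proof.
move=> Hs; have E := marker_response_integral Hs.
have mSR : measurable_fun setT (fun w => (S w == true)%:R : R).
  exact: measurable_eqbR.
have mMR c : measurable_fun setT (fun w => (Mp b w == c)%:R : R).
  exact: measurable_eqbR.
have mSM c : measurable_fun setT (fun w => (S w == true)%:R * (Mp b w == c)%:R : R)%R.
  exact: measurable_funM.
have I0 : \int[P]_w ((S w == true)%:R * (Mp b w == false)%:R)%:E = 0.
  set J := \int[P]_w ((S w == true)%:R * (Mp b w == true)%:R)%:E.
  (* Finiteness is what allows concluding I = 0 from I + J = J. *)
  have fJ : J \is a fin_num.
    rewrite ge0_fin_numE; last first.
      by apply: integral_ge0 => w _; rewrite lee_fin mulr_ge0.
    apply: (@le_lt_trans _ _ (\int[P]_w (cst 1 w))).
      apply: ge0_le_integral => //.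
      - exact/measurable_EFinP.
      - by move=> w _; rewrite lee_fin; do 2 case: (_ == _); rewrite ?(mulr1, mulr0).
    by rewrite integral_cst// mul1e -ge0_fin_numE// fin_num_measure.
  set I := LHS; have E' : I + J = J.
    rewrite [in RHS]/J E /I /J -ge0_integralD//.
    - apply: eq_integral => w _; rewrite -EFinD -mulrDr.
      by case: (Mp b w); rewrite /= ?addr0 ?add0r.
    - exact/measurable_EFinP.
    - exact/measurable_EFinP.
  by rewrite -(addeK I fJ) E' subee.
have /ge0_integral_eq0_ae := I0 => /(_ (mSM _) (fun w => mulr_ge0 (ler0n _ _) (ler0n _ _))).
apply: filterS2 (necessity_ae b) => w h0.
case: (S w) h0 => [_|/(_ erefl)->//]; rewrite mul1r; case: (Mp b w) => //= /eqP.
by rewrite oner_eq0.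
Qed.

(** * Weighting within the stratum S_M = m *)

Definition propensity_XS0 (a : bool) (z : TX * bool) : R :=
  condprob0 P (fun w => (X w, S w)) [set w | A w = a] z.

Definition pM_XS0 (m : bool) (z : bool * TX * bool) : R :=
  condprob0 P (fun w => (A w, X w, S w)) [set w | M w = m] z.

(** Serves as the weight [t] of [event_transfer]. It multiplies Y and the regression of Y alike, so
    its value never has to be known. *)
Definition pS_AMX0 (s : bool) (z : bool * bool * TX) : R :=
  condprob0 P (fun w => (A w, M w, X w)) [set w | S w = s] z.

(* The density of the law of (A, M) at (a, m) given X = x and S_M = m. *)
Definition marker_density (a m : bool) (x : TX) : R := (propensity_XS0 a (x, m) * pM_XS0 m (a, x, m))%R.

Lemma measurable_marker_density a m : measurable_fun setT (marker_density a m).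
Proof.
apply: measurable_funM.
  apply: (measurableT_comp (f := propensity_XS0 a) (g := fun x => (x, m))).
    exact: measurable_condprob0_bool.
  exact: measurable_fun_pair.
by apply: measurable_section_mid; exact: measurable_condprob0_bool.
Qed.

Lemma marker_density_ge0 a m x : (0 <= marker_density a m x)%R.
Proof. by rewrite mulr_ge0// condexp0_ge0. Qed.

(** The two factors of the density become indicators one at a time: independence from A given (X,
    S_M) turns the first into 1{A = a}, and independence from M given (A = a, X, S_M) then turns the
    second into 1{M = m}. *)
Lemma exchangeability_integral a m (h : R * TX -> R) :
  measurable_fun setT h -> (forall z, 0 <= h z)%R ->
  \int[P]_w (h (N a m w, X w) * ((S w == m)%:R * marker_density a m (X w)))%:E =
  \int[P]_w (h (N a m w, X w) * ((A w == a)%:R * (M w == m)%:R * (S w == m)%:R))%:E.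
Proof.
move=> mh h0; have [UV1 UV2] := a_exchangeability hV a m.
have mr : measurable_fun setT (pM_XS0 m) by exact: measurable_condprob0_bool.
(* The factor for M is kept inside the test function, as it depends only on (X, S_M) once a is
   fixed. *)
pose k (z : R * bool * (TX * bool)) : R :=
  (h (z.1.1, z.2.1) * ((z.2.2 == m)%:R * pM_XS0 m (a, z.2.1, z.2.2)))%R.
have m11 : measurable_fun setT (fun z : R * bool * (TX * bool) => z.1.1).
  exact: (measurableT_comp measurable_fst measurable_fst).
have m21 : measurable_fun setT (fun z : R * bool * (TX * bool) => z.2.1).
  exact: (measurableT_comp measurable_fst measurable_snd).
have m22 : measurable_fun setT (fun z : R * bool * (TX * bool) => z.2.2).
  exact: (measurableT_comp measurable_snd measurable_snd).
have mk : measurable_fun setT k.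
  apply: measurable_funM.
    by apply: (measurableT_comp mh); exact: measurable_fun_pair.
  apply: measurable_funM; first exact: measurable_eqbR.
  apply: (measurableT_comp mr); apply: measurable_fun_pair => //.
  exact: measurable_fun_pair.
have k0 z : (0 <= k z)%R by rewrite !mulr_ge0// condexp0_ge0.
have E1 := cond_indep_integral_bool (mNMp a m) mA mXS a UV1 mk k0.
transitivity (\int[P]_w (k (N a m w, Mp a w, (X w, S w)) * propensity_XS0 a (X w, S w))%:E).
  apply: eq_integral => w _; congr EFin; rewrite /k /marker_density /=.
  have [->|] := eqVneq (S w) m; last by rewrite !(mul0r, mulr0).
  by rewrite !mul1r -mulrA; congr (_ * _)%R; exact: mulrC.
etransitivity; first exact: (esym E1).
pose h2 (z : R * (bool * TX * bool)) : R := (h (z.1, z.2.1.2) * (z.2.2 == m)%:R)%R.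
have mh2 : measurable_fun setT h2.
  apply: measurable_funM.
    apply: (measurableT_comp mh); apply: measurable_fun_pair.
      exact: measurable_fst.
    apply: (measurableT_comp measurable_snd).
    exact: (measurableT_comp measurable_fst measurable_snd).
  apply: measurable_eqbR; exact: (measurableT_comp measurable_snd measurable_snd).
have h20 z : (0 <= h2 z)%R by rewrite mulr_ge0.
have mp : measurable_fun setT (fun z : bool * TX * bool => z.1.1).
  exact: (measurableT_comp measurable_fst measurable_fst).
have E2 := cond_indep_on_integral_bool (mN a m) mM mAXS m mp UV2 mh2 h20.
transitivity (\int[P]_w (h2 (N a m w, (A w, X w, S w)) *
    ((A w == a)%:R * pM_XS0 m (A w, X w, S w)))%:E).
  apply: eq_integral => w _; congr EFin; rewrite /k /h2 /=.
  have [->|] := eqVneq (A w) a; last by rewrite !(mul0r, mulr0).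
  by rewrite mulr1 mul1r mulrA.
etransitivity; first exact: (esym E2).
apply: eq_integral => w _; congr EFin; rewrite /h2 /= -mulrA; congr (_ * _)%R.
by rewrite mulrC.
Qed.

(** Consistency replaces Y(a,m) by Y on {A = a, M = m}; after that, Y and S_M are independent given
    (A, M, X), so the marker indicator may be averaged out. *)
Lemma outcome_marker_integral a m (h : R * TX -> R) :
  measurable_fun setT h -> (forall z, 0 <= h z)%R ->
  \int[P]_w (h (N a m w, X w) * ((A w == a)%:R * (M w == m)%:R * (S w == m)%:R))%:E =
  \int[P]_w (h (Y w, X w) * ((A w == a)%:R * (M w == m)%:R * pS_AMX0 m (a, m, X w)))%:E.
Proof.
move=> mh h0.
have mAMS : measurable_fun setT
    (fun w => (A w == a)%:R * (M w == m)%:R * (S w == m)%:R : R)%R.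
  by do ![apply: measurable_funM]; exact: measurable_eqbR.
transitivity (\int[P]_w (h (Y w, X w) *
    ((A w == a)%:R * (M w == m)%:R * (S w == m)%:R))%:E).
  apply: ae_eq_integralR.
  - by apply: measurable_funM => //; apply: measurableT_comp => //; exact: measurable_fun_pair.
  - by apply: measurable_funM => //; apply: measurableT_comp => //; exact: measurable_fun_pair.
  - apply: filterS (consistencyP a) => w.
    have [-> /(_ erefl)[_ ->]|] := eqVneq (A w) a; last by rewrite !(mul0r, mulr0).
    by have [->//|] := eqVneq (M w) m; rewrite !(mul0r, mulr0).
pose k (z : R * (bool * bool * TX)) : R :=
  (h (z.1, z.2.2) * ((z.2.1.1 == a)%:R * (z.2.1.2 == m)%:R))%R.
have m21 : measurable_fun setT (fun z : R * (bool * bool * TX) => z.2.1).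
  exact: (measurableT_comp measurable_fst measurable_snd).
have mk : measurable_fun setT k.
  apply: measurable_funM.
    apply: (measurableT_comp mh); apply: measurable_fun_pair.
      exact: measurable_fst.
    exact: (measurableT_comp measurable_snd measurable_snd).
  apply: measurable_funM; apply: measurable_eqbR.
    exact: (measurableT_comp measurable_fst m21).
  exact: (measurableT_comp measurable_snd m21).
have k0 z : (0 <= k z)%R by rewrite !mulr_ge0.
have E := cond_indep_integral_bool mY mS mAMX m (a_outcome_marker hV) mk k0.
transitivity (\int[P]_w (k (Y w, (A w, M w, X w)) * (S w == m)%:R)%:E).
  by apply: eq_integral => w _; rewrite /k /= -!mulrA.
etransitivity; first exact: E.
apply: eq_integral => w _; congr EFin; rewrite /k /pS_AMX0 /=.
have [->|] := eqVneq (A w) a; last by rewrite !(mul0r, mulr0).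
have [->|] := eqVneq (M w) m; last by rewrite !(mul0r, mulr0).
by rewrite !mul1r mulr1.
Qed.

(* Where the density vanishes, {A = a, M = m, S_M = m} is null.  For m = 0,
   necessity makes M = 0 automatic on {A = a, S_M = 0}, and blinding applies;
   for m = 1, necessity makes S_M = 1 automatic on {A = a, M = 1}, and
   positivity of P(M = 1 | A = a, X) applies. *)
Lemma marker_density_gt0 a m : {ae P, forall w, S w == m -> (0 < marker_density a m (X w))%R}.
Proof.
pose B (x : TX) : R := (\1_[set x | marker_density a m x = 0%R] x).
have mB : measurable_fun setT B.
  apply: measurable_indic.
  rewrite (_ : [set x | _] = marker_density a m @^-1` [set 0%R])// -[X in measurable X]setTI.
  exact: measurable_marker_density.
have B0 x : (0 <= B x)%R by [].
have Brho x : (B x * marker_density a m x = 0)%R.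
  rewrite /B indicE; case: (boolP (x \in _)) => /=; rewrite ?mul0r// inE /= => ->.
  by rewrite mulr0.
suff H : {ae P, forall w, (B (X w) * (S w == m)%:R = 0)%R}.
  apply: filterS H => w + Sm; rewrite Sm mulr1 /B indicE.
  case: (boolP (X w \in _)) => /=; first by move=> _ /eqP; rewrite oner_eq0.
  rewrite notin_setE /= => h _.
  by rewrite lt_neqAle marker_density_ge0 andbT eq_sym; exact/eqP.
have mBX : measurable_fun setT (fun w => B (X w)) by exact: measurableT_comp.
have mB2 : measurable_fun setT (fun z : R * TX => B z.2).
  exact: (measurableT_comp mB measurable_snd).
have E := exchangeability_integral a m mB2 (fun z => B0 z.2).
(* The test function is the indicator of the zero set of the density, so the density side of the
   exchangeability identity vanishes. *)
have {}E : \int[P]_w (B (X w) * ((A w == a)%:R * (M w == m)%:R * (S w == m)%:R))%:E = 0.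
  etransitivity; first exact: (esym E).
  apply: integral0_eq => w _; congr EFin.
  by rewrite mulrCA -[X in (_ * X)%R]/(B (X w) * marker_density a m (X w))%R Brho mulr0.
have mbR (F : Omega V -> bool) c : measurable_fun setT F ->
    measurable_fun setT (fun w => (F w == c)%:R : R) by exact: measurable_eqbR.
have mAMS : measurable_fun setT
    (fun w => (A w == a)%:R * (M w == m)%:R * (S w == m)%:R : R)%R.
  by do ![apply: measurable_funM]; exact: measurable_eqbR.
have mBAMS : measurable_fun setT
    (fun w => B (X w) * ((A w == a)%:R * (M w == m)%:R * (S w == m)%:R))%R.
  exact: measurable_funM.
case: m @B mB B0 Brho mBX mB2 E mAMS mBAMS => B mB B0 _ mBX _ E mAMS mBAMS.
- have E1 : \int[P]_w (B (X w) * ((A w == a)%:R * (M w == true)%:R))%:E = 0.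
    rewrite -[RHS]E; apply: ae_eq_integralR => //.
      by do ![apply: measurable_funM] => //; exact: mbR.
    apply: filterS2 (consistencyP a) (necessity_ae a) => w h1 h2; congr (_ * _)%R.
    have [/h1[MMp _]|] := eqVneq (A w) a; last by rewrite !mul0r.
    rewrite MMp; case: (S w) h2 => [_|/(_ erefl)->]; first by rewrite mulr1.
    by rewrite !mulr0.
  have mBp : measurable_fun setT (fun x => B x * pM0 true a x)%R.
    by apply: measurable_funM => //; exact: measurable_pM0.
  have Bp0 x : (0 <= B x * pM0 true a x)%R by rewrite mulr_ge0// pM0_ge0.
  have E2 := mediator_integral true a mB B0.
  have E3 := propensity_integral a mBp Bp0.
  have /ge0_integral_eq0_ae : \int[P]_w (B (X w) * pM0 true a (X w) * propensity0 a (X w))%:E = 0.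
    by rewrite -E3 -E2.
  move=> H; have {}H : {ae P, forall w, (B (X w) * pM0 true a (X w) * propensity0 a (X w) = 0)%R}.
    apply: H; last by move=> w; rewrite !mulr_ge0// ?pM0_ge0 ?propensity0_ge0.
    apply: measurable_funM; first exact: (measurableT_comp mBp mX).
    exact: (measurableT_comp (measurable_propensity0 a) mX).
  (* The product of the zero-set indicator with two almost surely positive factors is 0, hence the
     indicator is. *)
  apply: filterS3 (filterI H (propensity0_gt0 a)) (pM0_pM true a) (pM_gt0 true a).
  move=> w [/eqP h e1] ep p1; move: h.
  by rewrite !mulf_eq0 (gt_eqF e1) ep (gt_eqF p1) !orbF => /eqP->; rewrite mul0r.
- have E1 : \int[P]_w (B (X w) * (S w == false)%:R * (A w == a)%:R)%:E = 0.
    rewrite -[RHS]E; apply: ae_eq_integralR => //.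
      by do ![apply: measurable_funM] => //; exact: mbR.
    apply: filterS2 (consistencyP a) (necessity_ae a) => w h1 h2.
    rewrite -mulrA; congr (_ * _)%R.
    have [/h1[MMp _]|] := eqVneq (A w) a; last by rewrite !(mul0r, mulr0).
    rewrite MMp; case: (S w) h2 => [_|/(_ erefl)->]; rewrite ?(mulr0, mul0r, mulr1)//.
  pose k (z : bool * TX) : R := (B z.2 * (z.1 == false)%:R)%R.
  have mk : measurable_fun setT k.
    apply: measurable_funM; first exact: (measurableT_comp mB measurable_snd).
    by apply: measurable_eqbR; exact: measurable_fst.
  have k0 z : (0 <= k z)%R by rewrite mulr_ge0.
  have E2 := blinding_integral a mk k0.
  have /ge0_integral_eq0_ae : \int[P]_w (k (S w, X w) * propensity0 a (X w))%:E = 0.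
    by rewrite -E2.
  move=> H; have {}H : {ae P, forall w, (k (S w, X w) * propensity0 a (X w) = 0)%R}.
    apply: H; last by move=> w; rewrite mulr_ge0// propensity0_ge0.
    apply: measurable_funM; first exact: (measurableT_comp mk mSX).
    exact: (measurableT_comp (measurable_propensity0 a) mX).
  apply: filterS2 H (propensity0_gt0 a) => w /eqP + e1.
  by rewrite mulf_eq0 (gt_eqF e1) orbF => /eqP.
Qed.

(** The cross-world ingredient: G = {S_M = m}, weighted by the density of (A, M) in this stratum. *)
Lemma marker_transfer a m : P.-integrable setT (fun w => (Y w)%:E) ->
  P.-integrable setT (fun w => (N a m w * (S w == m)%:R)%:E) ->
  P.-integrable setT (fun w => (muY V a m (X w) * (S w == m)%:R)%:E) /\
  \int[P]_w (muY V a m (X w) * (S w == m)%:R)%:E =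
  \int[P]_w (N a m w * (S w == m)%:R)%:E.
Proof.
apply: (@event_transfer a m (fun w => S w == m) (marker_density a m)
  (fun x => pS_AMX0 m (a, m, x))).
- exact: (measurableT_comp (f := fun b : bool => b == m)).
- exact: measurable_marker_density.
- exact: marker_density_ge0.
- by apply: measurable_section1; exact: measurable_condprob0_bool.
- by move=> x; exact: condexp0_ge0.
- move=> h mh h0; rewrite -outcome_marker_integral//.
  exact: exchangeability_integral.
- exact: marker_density_gt0.
Qed.

(** The single-world counterpart, with G = {M(a) = m}, the propensity as density and t = 1. It
    serves Y(a) when M(a) may differ from the marker. *)
Lemma potM_transfer a m : P.-integrable setT (fun w => (Y w)%:E) ->
  P.-integrable setT (fun w => (N a m w * (Mp a w == m)%:R)%:E) ->
  P.-integrable setT (fun w => (muY V a m (X w) * (Mp a w == m)%:R)%:E) /\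
  \int[P]_w (muY V a m (X w) * (Mp a w == m)%:R)%:E =
  \int[P]_w (N a m w * (Mp a w == m)%:R)%:E.
Proof.
apply: (@event_transfer a m (fun w => Mp a w == m) (propensity0 a) (cst 1%R)) => //.
- exact: (measurableT_comp (f := fun b : bool => b == m)).
- exact: measurable_propensity0.
- exact: propensity0_ge0.
- move=> h mh h0.
  pose k (z : R * bool * TX) : R := (h (z.1.1, z.2) * (z.1.2 == m)%:R)%R.
  have mk : measurable_fun setT k.
    apply: measurable_funM.
      apply: (measurableT_comp mh); apply: measurable_fun_pair.
        exact: (measurableT_comp measurable_fst measurable_fst).
      exact: measurable_snd.
    apply: measurable_eqbR; exact: (measurableT_comp measurable_snd measurable_fst).
  have k0 z : (0 <= k z)%R by rewrite mulr_ge0.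
  have E := ignorability_integral a m mk k0.
  transitivity (\int[P]_w (k (N a m w, Mp a w, X w) * propensity0 a (X w))%:E).
    by apply: eq_integral => w _; rewrite /k /= mulrA.
  etransitivity; first exact: (esym E).
  apply: ae_eq_integralR.
  - apply: measurable_funM; last exact: measurable_eqbR.
    by apply: (measurableT_comp mk); exact: measurable_fun_pair.
  - apply: measurable_funM.
      by apply: (measurableT_comp mh); exact: measurable_fun_pair.
    by do ![apply: measurable_funM] => //; exact: measurable_eqbR.
  - apply: filterS (consistencyP a) => w; rewrite /k /=.
    have [-> /(_ erefl)[<- ->]|] := eqVneq (A w) a; last by rewrite !(mul0r, mulr0).
    by have [->|] := eqVneq (M w) m; rewrite !(mul0r, mulr0, mulr1, mul1r).
- by apply: filterS (propensity0_gt0 a) => w.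
Qed.

(** * Conditioning on the event S_M = s *)

Let mSE s : measurable_fun setT (fun w => (S w == s)%:R : R).
Proof. exact: measurable_eqbR. Qed.

Lemma pS_fin_num s : pS V s \is a fin_num.
Proof. by rewrite fin_num_measure//; exact: measurable_S_eq. Qed.

Lemma Pr_given_SE s B : 0 < pS V s -> measurable B ->
  Pr_given_S V s B = P (B `&` S @^-1` [set s]) * (pS V s)^-1.
Proof.
move=> ps mB; have fs := pS_fin_num s.
have pE : mrestr P (measurable_S_eq V s) setT = pS V s by rewrite /mrestr setTI.
rewrite /Pr_given_S /= /mnormalize /= [mrestr P _ setT]pE.
rewrite gt_eqF//= lt_eqF ?ltey_eq ?fs//= /mrestr; congr (_ * _).
by rewrite -[in RHS](fineK fs) inver fine_eq0// gt_eqF.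
Qed.

(** The conditional law scaled by P(S_M = s) is the restriction of P to the event; multiplying
    avoids division in the extended reals. *)
Lemma ge0_integral_given_S s (f : Omega V -> R) : 0 < pS V s ->
  measurable_fun setT f -> (forall w, 0 <= f w)%R ->
  pS V s * \int[Pr_given_S V s]_w (f w)%:E = \int[P]_w (f w * (S w == s)%:R)%:E.
Proof.
move=> ps mf f0; have fs := pS_fin_num s.
have r0 : (0 <= fine (pS V s))%R by rewrite fine_ge0// ltW.
transitivity (\int[mscale (NngNum r0) (Pr_given_S V s)]_w (f w)%:E).
  rewrite ge0_integral_mscale//=; [by rewrite fineK|exact/measurable_EFinP|].
  by move=> w _; rewrite lee_fin.
transitivity (\int[mrestr P (measurable_S_eq V s)]_w (f w)%:E).
  apply: eq_measure_integral => B mB _.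
  rewrite /= /mscale /= fineK// Pr_given_SE// muleCA.
  by rewrite divee ?mule1// gt_eqF.
rewrite ge0_integral_mrestr//; apply: eq_integral => w _.
by rewrite indic_eq_event.
Qed.

Lemma integral_given_S s (f : Omega V -> R) : 0 < pS V s -> measurable_fun setT f ->
  P.-integrable setT (fun w => (f w * (S w == s)%:R)%:E) ->
  (Pr_given_S V s).-integrable setT (fun w => (f w)%:E) /\
  pS V s * \int[Pr_given_S V s]_w (f w)%:E = \int[P]_w (f w * (S w == s)%:R)%:E.
Proof.
move=> ps mf ifS; have fs := pS_fin_num s.
have iQ : (Pr_given_S V s).-integrable setT (fun w => (f w)%:E).
  apply/integrableP; split; first exact/measurable_EFinP.
  rewrite -(@lte_pmul2l _ (pS V s))// gt0_muley// -[X in _ * X]/(\int[_]_w (`|f w|)%:E).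
  rewrite ge0_integral_given_S//; last exact: measurableT_comp.
  case/integrableP: ifS => _; apply: le_lt_trans.
  by under [leRHS]eq_integral do rewrite /= normrM [X in (_ * X)%R]ger0_norm//.
split => //; rewrite [X in _ * X = _]integralE [RHS]integralE muleBr//; last first.
  rewrite fin_num_adde_defr// ?fin_numN integrable_fin_num//.
    exact: integrable_funepos.
have pE (g : R -> R) : (forall x, 0 <= g x)%R -> measurable_fun setT g ->
    pS V s * \int[Pr_given_S V s]_w (g (f w))%:E =
    \int[P]_w (g (f w) * (S w == s)%:R)%:E.
  by move=> g0 mg; apply: ge0_integral_given_S => //; exact: measurableT_comp.
congr (_ - _).
- transitivity (pS V s * \int[Pr_given_S V s]_w (Num.max (f w) 0%R)%:E).
    by congr (_ * _); apply: eq_integral => w _; rewrite funeposE EFin_max.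
  rewrite (pE (fun x : R => Num.max x 0%R : R))//; last 2 first.
  + by move=> x; rewrite le_max lexx orbT.
  + exact: measurable_maxr.
  apply: eq_integral => w _; rewrite funeposE -EFin_max.
  by rewrite maxr_pMl// mul0r.
- transitivity (pS V s * \int[Pr_given_S V s]_w (Num.max (- f w)%R 0%R)%:E).
    by congr (_ * _); apply: eq_integral => w _; rewrite funenegE EFin_max.
  rewrite (pE (fun x : R => Num.max (- x)%R 0%R : R))//; last 2 first.
  + by move=> x; rewrite le_max lexx orbT.
  + by apply: measurable_maxr => //; exact: measurable_funN.
  apply: eq_integral => w _; rewrite funenegE -EFinN -EFin_max.
  by rewrite maxr_pMl// mul0r mulNr.
Qed.

(** If P(S_M = s) = 0, the conditional law is P by convention and the expectation has no meaning,
    but the product is 0, even for an infinite expectation, and the right side lives on a null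
    event. The decompositions thus need no case distinction. *)
Lemma expectation_given_SM s (f : Omega V -> R) : measurable_fun setT f ->
  P.-integrable setT (fun w => (f w * (S w == s)%:R)%:E) ->
  'E_(Pr_given_S V s)[f] * pS V s = \int[P]_w (f w * (S w == s)%:R)%:E.
Proof.
move=> mf ifS; rewrite unlock muleC.
have : 0 <= pS V s by exact: measure_ge0.
rewrite le_eqVlt => /predU1P[ps0|ps]; last by have [] := integral_given_S ps mf ifS.
rewrite -ps0 mul0e -[LHS](integral0 P setT); apply: ae_eq_integralR => //.
  exact: measurable_funM.
exists (S @^-1` [set s]); split; [exact: measurable_S_eq|exact: esym|].
move=> w /= h; apply: contrapT => /eqP/negbTE Ss; apply: h.
by rewrite Ss mulr0.
Qed.

Lemma integrable_mul_eqb (f : Omega V -> R) (F : Omega V -> bool) c :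
  measurable_fun setT F -> P.-integrable setT (fun w => (f w)%:E) ->
  P.-integrable setT (fun w => (f w * (F w == c)%:R)%:E).
Proof.
move=> mF fi; have mf : measurable_fun setT f.
  by apply/measurable_EFinP; exact: (measurable_int P).
apply: le_integrable fi => //.
  by apply/measurable_EFinP; apply: measurable_funM => //; exact: measurable_eqbR.
move=> w _; rewrite /= lee_fin normrM ler_piMr//.
by case: (_ == _); rewrite ?normr1 ?normr0.
Qed.

(** By consistency Y is almost surely Y(1) on {A = 1} and Y(0) on {A = 0}. *)
Lemma outY_integrable : (forall a, Ycross_integrable V a a) ->
  P.-integrable setT (fun w => (Y w)%:E).
Proof.
move=> iY.
have i1 a := integrable_mul_eqb a mA (iY a).
have i2 : P.-integrable setT (fun w => (Ycross V true true w * (A w == true)%:R +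
    Ycross V false false w * (A w == false)%:R)%:E).
  by under eq_fun do rewrite EFinD; apply: integrableD.
apply: ae_integrable i2 => //.
apply: filterS2 (consistencyP true) (consistencyP false) => w.
case: (A w) => [/(_ erefl)[e ->] _|_ /(_ erefl)[e ->]];
  by rewrite mulr1 mulr0 ?addr0 ?add0r /Ycross -e.
Qed.

Lemma Ycross_eqb a a' m w :
  (Ycross V a a' w * (Mp a' w == m)%:R = N a m w * (Mp a' w == m)%:R)%R.
Proof. by rewrite /Ycross; have [->|] := eqVneq (Mp a' w) m; rewrite ?mulr0. Qed.

Lemma integrable_Ycross_eqb a a' m : Ycross_integrable V a a' ->
  P.-integrable setT (fun w => (N a m w * (Mp a' w == m)%:R)%:E).
Proof.
move=> ic; have := integrable_mul_eqb m (mMp a') ic.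
by under eq_fun do rewrite Ycross_eqb.
Qed.

Lemma lawX_pM0_pM m a : {ae lawX V, forall x, pM0 m a x = pM V m a x}.
Proof.
apply: filterS (a_positivity hV) => x /(_ a m) [_ h].
by rewrite /pM0 /condprob0 /condexp0 max_r// ltW.
Qed.

Lemma measurable_pM m a : measurable_fun setT (pM V m a).
Proof.
have [mc _ _] := condexpP mAX (integrable_indic1 P (measurable_bool_event mM m)).
exact: (measurable_section1 a mc).
Qed.

Lemma measurable_muY a m : P.-integrable setT (fun w => (Y w)%:E) ->
  measurable_fun setT (muY V a m).
Proof.
by move=> iY; have [mc _ _] := condexpP mAMX iY; exact: (measurable_section1 (a, m) mc).
Qed.

(** * Means and effects for an arm b with M(b) = S_M *)

Section arm.
Variables (b : bool).
Hypotheses (MS : {ae P, forall w, Mp b w = S w})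
  (iY : P.-integrable setT (fun w => (Y w)%:E)).

Lemma integral_eq_SM (f : Omega V -> R) s : measurable_fun setT f ->
  \int[P]_w (f w * (S w == s)%:R)%:E = \int[P]_w (f w * (Mp b w == s)%:R)%:E.
Proof.
move=> mf; apply: ae_eq_integralR.
- exact: measurable_funM.
- by apply: measurable_funM => //; exact: measurable_eqbR.
- by apply: filterS MS => w ->.
Qed.

Lemma integrable_SM (f : Omega V -> R) s : measurable_fun setT f ->
  P.-integrable setT (fun w => (f w * (S w == s)%:R)%:E) <->
  P.-integrable setT (fun w => (f w * (Mp b w == s)%:R)%:E).
Proof.
move=> mf; split; apply: ae_integrable.
- by apply: measurable_funM => //; exact: measurable_eqbR.
- by apply: filterS MS => w ->.
- exact: measurable_funM.
- by apply: filterS MS => w ->.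
Qed.

(** Since S_M = M(b) almost surely, the unobserved marker inherits P(S_M = s | X) = P(M = s | A = b,
    X). Taking B to be everything gives P(S_M = s); dividing by it gives the law of X given S_M =
    s. *)
Lemma prob_SX s B : measurable B ->
  P (X @^-1` B `&` S @^-1` [set s]) = \int[lawX V]_(x in B) (pM V s b x)%:E.
Proof.
move=> mB; have mXB : measurable (X @^-1` B) by exact: measurable_funPTI.
have mB1 : measurable_fun setT (\1_B : TX -> R) by exact: measurable_indic.
have mBX : measurable_fun setT (fun w => \1_B (X w) : R) by exact: measurableT_comp.
rewrite -[X in P X]setIT -(@integral_indic _ _ _ P setT)//; last first.
  by apply: measurableI => //; exact: measurable_S_eq.
transitivity (\int[P]_w (\1_B (X w) * (S w == s)%:R)%:E).
  by apply: eq_integral => w _; rewrite indicI /= indic_eq_event.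
rewrite integral_eq_SM//; etransitivity; first exact: potM_integral.
rewrite -[RHS]integral_indicM.
transitivity (\int[lawX V]_x (\1_B x * pM0 s b x)%:E).
  rewrite ge0_integral_distribution//; last 2 first.
  - by apply/measurable_EFinP; apply: measurable_funM => //; exact: measurable_pM0.
  - by move=> x; rewrite lee_fin mulr_ge0// pM0_ge0.
apply: ae_eq_integralR.
- by apply: measurable_funM => //; exact: measurable_pM0.
- by apply: measurable_funM => //; exact: measurable_pM.
- by apply: filterS (lawX_pM0_pM s b) => x ->.
Qed.

Lemma pS_pM s : pS V s = \int[lawX V]_x (pM V s b x)%:E.
Proof. by rewrite -prob_SX// preimage_setT setTI. Qed.

(** There are two routes to the regression: ignorability when a' = a, the marker when a' = b. Once
    Y(a,m) has become a function of X, the indicator of M(a') is averaged to P(M = m | A = a',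
    X). *)
Lemma cross_moment a a' m : a' = a \/ a' = b -> Ycross_integrable V a a' ->
  [/\ P.-integrable setT (fun w => (muY V a m (X w) * (Mp a' w == m)%:R)%:E),
    \int[P]_w (muY V a m (X w) * (Mp a' w == m)%:R)%:E =
      \int[P]_w (N a m w * (Mp a' w == m)%:R)%:E,
    (lawX V).-integrable setT (fun x => (muY V a m x * pM V m a' x)%:E) &
    \int[P]_w (N a m w * (Mp a' w == m)%:R)%:E =
      \int[lawX V]_x (muY V a m x * pM V m a' x)%:E].
Proof.
move=> ha ic; have iN := integrable_Ycross_eqb m ic.
have mmu := measurable_muY a m iY.
have mmuX : measurable_fun setT (fun w => muY V a m (X w)) by exact: measurableT_comp.
have [i1 E1] : P.-integrable setT (fun w => (muY V a m (X w) * (Mp a' w == m)%:R)%:E) /\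
    \int[P]_w (muY V a m (X w) * (Mp a' w == m)%:R)%:E =
      \int[P]_w (N a m w * (Mp a' w == m)%:R)%:E.
  case: ha => ha; move: iN; rewrite ha; first exact: potM_transfer.
  move=> /integrable_SM -/(_ (mN a m)) /(marker_transfer iY)[i1 E1]; split.
    exact/integrable_SM.
  by rewrite -!integral_eq_SM.
have m0 := measurable_pM0 m a'.
have mp := measurable_pM m a'.
(* [potM_integral] is stated for nonnegative functions, while the regression is signed and known
   only to be integrable against the indicator. *)
have [i2 E2] := @eq_integral_comp_signed _ _ _ P _ _ X X
  (fun w => (Mp a' w == m)%:R) (fun w => pM0 m a' (X w)) mX (fun w => ler0n _ _)
  (measurableT_comp m0 mX) (fun w => pM0_ge0 _ _ _)
  (fun h mh h0 => potM_integral m a' mh h0) _ mmu i1.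
have mm0 : measurable_fun setT (fun x => muY V a m x * pM0 m a' x)%R.
  exact: measurable_funM.
have mmp : measurable_fun setT (fun x => muY V a m x * pM V m a' x)%R.
  exact: measurable_funM.
have mm0E : measurable_fun setT (fun x => (muY V a m x * pM0 m a' x)%:E).
  exact/measurable_EFinP.
have i3 : (lawX V).-integrable setT (fun x => (muY V a m x * pM0 m a' x)%:E).
  exact: integrable_pushforward.
have e3 : {ae lawX V, forall x, (muY V a m x * pM0 m a' x = muY V a m x * pM V m a' x)%R}.
  by apply: filterS (lawX_pM0_pM m a') => x ->.
split => //; first exact: ae_integrable e3 i3.
rewrite -E1 E2 -(ae_eq_integralR mm0 mmp e3).
by rewrite integral_distribution.
Qed.

Lemma Ycross_split a a' w : Ycross V a a' w =
  (N a true w * (Mp a' w == true)%:R + N a false w * (Mp a' w == false)%:R)%R.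
Proof.
by rewrite /Ycross; case: (Mp a' w); rewrite ?mulr1 ?mulr0 ?addr0 ?add0r.
Qed.

Lemma cross_mean a a' : a' = a \/ a' = b -> Ycross_integrable V a a' ->
  (lawX V).-integrable setT
    (fun x => (\sum_(m : bool) muY V a m x * pM V m a' x)%R%:E) /\
  \int[P]_w (Ycross V a a' w)%:E =
    \int[lawX V]_x (\sum_(m : bool) muY V a m x * pM V m a' x)%R%:E.
Proof.
move=> ha ic.
have [_ _ i1 E1] := cross_moment true ha ic.
have [_ _ i0 E0] := cross_moment false ha ic.
split.
  under eq_fun do rewrite big_bool /= EFinD.
  exact: integrableD.
under eq_integral do rewrite Ycross_split EFinD.
rewrite integralD//; try exact: integrable_Ycross_eqb.
under [RHS]eq_integral do rewrite big_bool /= EFinD.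
by rewrite integralD// E1 E0.
Qed.

Hypothesis iC : forall a, Ycross_integrable V a b.

(** On {S_M = s} the variable Y(a,s) is almost surely Y(a,M(b)), which provides integrability there
    although Y(a,s) alone may have no mean. *)
Lemma contrast_given_S s :
  P.-integrable setT (fun w => ((N true s w - N false s w) * (S w == s)%:R)%:E) /\
  P.-integrable setT
    (fun w => ((muY V true s (X w) - muY V false s (X w)) * (S w == s)%:R)%:E) /\
  \int[P]_w ((N true s w - N false s w) * (S w == s)%:R)%:E =
  \int[P]_w ((muY V true s (X w) - muY V false s (X w)) * (S w == s)%:R)%:E.
Proof.
have iN a : P.-integrable setT (fun w => (N a s w * (S w == s)%:R)%:E).
  by apply/integrable_SM => //; exact: integrable_Ycross_eqb.
have mmu a : measurable_fun setT (fun w => muY V a s (X w)).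
  by apply: measurableT_comp => //; exact: measurable_muY.
have [i1 E1] : P.-integrable setT (fun w => (muY V true s (X w) * (S w == s)%:R)%:E) /\
    \int[P]_w (muY V true s (X w) * (S w == s)%:R)%:E =
      \int[P]_w (N true s w * (S w == s)%:R)%:E.
  have [i E _ _] := cross_moment s (or_intror erefl) (iC true); split.
    exact/integrable_SM.
  by rewrite !integral_eq_SM.
have [i0 E0] : P.-integrable setT (fun w => (muY V false s (X w) * (S w == s)%:R)%:E) /\
    \int[P]_w (muY V false s (X w) * (S w == s)%:R)%:E =
      \int[P]_w (N false s w * (S w == s)%:R)%:E.
  have [i E _ _] := cross_moment s (or_intror erefl) (iC false); split.
    exact/integrable_SM.
  by rewrite !integral_eq_SM.
split; [|split].
- by under eq_fun do rewrite mulrBl EFinB; exact: integrableB.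
- by under eq_fun do rewrite mulrBl EFinB; exact: integrableB.
- under eq_integral do rewrite mulrBl EFinB.
  under [RHS]eq_integral do rewrite mulrBl EFinB.
  by rewrite !integralB// E1 E0.
Qed.

(** Multiplied by P(S_M = s) > 0, both sides become integrals over {S_M = s} under P, where the
    potential outcomes and the regressions have equal integrals. *)
Lemma Delta_dirE s : 0 < pS V s -> Delta_dir V s =
  \int[lawX_given_S V s]_x (muY V true s x - muY V false s x)%R%:E.
Proof.
move=> ps; have [i1 [i2 E]] := contrast_given_S s.
have mmu : measurable_fun setT (fun x => muY V true s x - muY V false s x)%R.
  by apply: measurable_funB; exact: measurable_muY.
have mD : measurable_fun setT (fun w => N true s w - N false s w)%R.
  exact: measurable_funB.
have [_ E1] := integral_given_S ps mD i1.
have [j2 E2] := integral_given_S ps (measurableT_comp mmu mX) i2.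
rewrite /Delta_dir unlock /lawX_given_S integral_distribution//; last exact/measurable_EFinP.
by apply: (eqe_pmul2l (pS_fin_num s) ps); rewrite E1 E E2.
Qed.

Lemma lawX_given_SE s B : 0 < pS V s -> measurable B ->
  lawX_given_S V s B =
  (\int[lawX V]_(x in B) (pM V s b x)%:E) / (\int[lawX V]_x (pM V s b x)%:E).
Proof.
move=> ps mB; rewrite -pS_pM -prob_SX// -Pr_given_SE//.
exact: measurable_funPTI.
Qed.

(** On {S_M = s} the mediator M(b) is fixed at s, so the effect there is the controlled contrast at
    s. *)
Lemma direct_effect_decomp : direct_effect V b =
  Delta_dir V true * pS V true + Delta_dir V false * pS V false.
Proof.
have mD s : measurable_fun setT (fun w => N true s w - N false s w)%R.
  exact: measurable_funB.
have [i1 _] := contrast_given_S true; have [i0 _] := contrast_given_S false.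
rewrite /Delta_dir (expectation_given_SM (mD true))// (expectation_given_SM (mD false))//.
rewrite (integral_eq_SM _ (mD true)) (integral_eq_SM _ (mD false)).
move/(integrable_SM _ (mD true)) : i1 => i1; move/(integrable_SM _ (mD false)) : i0 => i0.
rewrite -integralD// /direct_effect unlock; apply: eq_integral => w _.
rewrite -EFinD; congr EFin; rewrite /Ycross.
by case: (Mp b w); rewrite ?mulr1 ?mulr0 ?addr0 ?add0r.
Qed.

Lemma expectation_Ycross a a' : a' = a \/ a' = b -> Ycross_integrable V a a' ->
  'E_P[Ycross V a a'] =
    \int[lawX V]_x (\sum_(m : bool) muY V a m x * pM V m a' x)%R%:E.
Proof. by move=> ha ic; rewrite unlock; have [_ ->] := cross_mean ha ic. Qed.

(** Only [muY], [pM] and the law of X occur on the right; this form, rather than the decomposition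
    over the marker, yields identification. *)
Lemma direct_effectE : direct_effect V b =
  \int[lawX V]_x (\sum_(m : bool) muY V true m x * pM V m b x)%R%:E -
  \int[lawX V]_x (\sum_(m : bool) muY V false m x * pM V m b x)%R%:E.
Proof.
rewrite -(expectation_Ycross (or_intror erefl) (iC true)).
rewrite -(expectation_Ycross (or_intror erefl) (iC false)).
rewrite /direct_effect unlock.
transitivity (\int[P]_w ((Ycross V true b w)%:E - (Ycross V false b w)%:E)).
  by apply: eq_integral => w _; rewrite EFinB.
by apply: integralB => //; exact: iC.
Qed.

(** The condition on c says that a is the arm other than b, so that M(0) and M(1) are each reached
    by one route of [cross_mean]. *)
Lemma indirect_effectE a : (forall c, c = a \/ c = b) -> Ycross_integrable V a a ->
  indirect_effect V a = \int[lawX V]_x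
    (\sum_(m : bool) muY V a m x * (pM V m true x - pM V m false x))%R%:E.
Proof.
move=> ab ia.
have ic c : Ycross_integrable V a c by case: (ab c) => ->.
have [i1 E1] := cross_mean (ab true) (ic true).
have [i0 E0] := cross_mean (ab false) (ic false).
transitivity (\int[P]_w (Ycross V a true w)%:E - \int[P]_w (Ycross V a false w)%:E).
  rewrite /indirect_effect unlock.
  transitivity (\int[P]_w ((Ycross V a true w)%:E - (Ycross V a false w)%:E)).
    by apply: eq_integral => w _; rewrite EFinB.
  by apply: integralB => //; exact: ic.
rewrite E1 E0 -integralB//; apply: eq_integral => x _; rewrite -EFinB; congr EFin.
by rewrite !big_bool /= !mulrBr opprD addrACA.
Qed.

(** Z stays abstract because the contrasts of the two parts subtract in opposite orders. *)
Lemma indirect_effect_given_S a (Z : Omega V -> R) :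
  (forall c, c = a \/ c = b) -> Ycross_integrable V a a -> measurable_fun setT Z ->
  {ae P, forall w,
    (Z w * (S w == true)%:R = Ycross V a true w - Ycross V a false w)%R} ->
  indirect_effect V a = 'E_(Pr_given_S V true)[Z] * pS V true.
Proof.
move=> ab ia mZ ZE.
have ic c : Ycross_integrable V a c by case: (ab c) => ->.
have mc c : measurable_fun setT (Ycross V a c).
  by apply/measurable_EFinP; exact: (measurable_int P (ic c)).
have iB : P.-integrable setT (fun w => (Ycross V a true w - Ycross V a false w)%:E).
  by under eq_fun do rewrite EFinB; apply: integrableB => //; exact: ic.
have mB : measurable_fun setT (fun w => Ycross V a true w - Ycross V a false w)%R.
  exact: measurable_funB.
have mZS : measurable_fun setT (fun w => Z w * (S w == true)%:R)%R.
  exact: measurable_funM.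
have iZ : P.-integrable setT (fun w => (Z w * (S w == true)%:R)%:E).
  by apply: ae_integrable iB => //; apply: filterS ZE => w ->.
rewrite expectation_given_SM// /indirect_effect unlock; apply: ae_eq_integralR => //.
by apply: filterS ZE => w ->.
Qed.

(** If S_M = 0, necessity gives M(a) = M(b) = 0 and there is no indirect effect; if S_M = 1, then
    M(b) = 1. Hence the stratum S_M = 1 carries the whole effect. *)
Lemma Ya_sub_ae a : {ae P, forall w,
  ((Ya V a w - N a true w) * (S w == true)%:R = Ycross V a a w - Ycross V a b w)%R}.
Proof.
apply: filterS2 MS (necessity_ae a) => w e h; rewrite /Ya /Ycross e.
case: (S w) h => [_|/(_ erefl)->]; first by rewrite mulr1.
by rewrite mulr0 subrr.
Qed.

Lemma measurable_Ya a : Ycross_integrable V a a -> measurable_fun setT (Ya V a).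
Proof. by move=> ia; apply/measurable_EFinP; exact: (measurable_int P ia). Qed.

End arm.

End identification.

(** * Dependence on the observed law only *)

Section same_law.
Context (R : realType) (dX : measure_display) (TX : measurableType dX)
  (V V' : setting R TX).
Hypothesis law : same_observed_law V V'.

Let RVm (U : setting R TX) : [/\ measurable_fun setT (covX U),
  measurable_fun setT (expA U), measurable_fun setT (medM U) &
  measurable_fun setT (outY U)].
Proof. by split; exact: measurable_funPT. Qed.

Let law_map d (T : measurableType d) (phi : TX * bool * bool * R -> T) (B : set T) :
  measurable_fun setT phi -> measurable B ->
  Pr V ((fun w => phi (covX V w, expA V w, medM V w, outY V w)) @^-1` B) =
  Pr V' ((fun w => phi (covX V' w, expA V' w, medM V' w, outY V' w)) @^-1` B).
Proof.
move=> mphi mB; apply: (law (B := phi @^-1` B)).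
by rewrite -[X in measurable X]setTI; exact: mphi.
Qed.

Let m1 : measurable_fun setT (fun z : TX * bool * bool * R => z.1.1.1).
Proof.
apply: (measurableT_comp measurable_fst).
exact: (measurableT_comp measurable_fst measurable_fst).
Qed.
Let m2 : measurable_fun setT (fun z : TX * bool * bool * R => z.1.1.2).
Proof.
apply: (measurableT_comp measurable_snd).
exact: (measurableT_comp measurable_fst measurable_fst).
Qed.
Let m3 : measurable_fun setT (fun z : TX * bool * bool * R => z.1.2).
Proof. exact: (measurableT_comp measurable_snd measurable_fst). Qed.

Lemma same_law_lawX (f : TX -> \bar R) :
  \int[lawX V]_x f x = \int[lawX V']_x f x.
Proof. by apply: eq_measure_integral => B mB _; exact: (law_map m1 mB). Qed.

Lemma same_law_pM m a x : pM V m a x = pM V' m a x.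
Proof.
rewrite /pM /condprob.
have [mX mA mM _] := RVm V; have [mX' mA' mM' _] := RVm V'.
congr (_ _); apply: same_law_condexp.
- exact: measurable_fun_pair.
- exact: measurable_fun_pair.
- exact/measurable_indic/measurable_bool_event.
- exact/measurable_indic/measurable_bool_event.
- move=> B mB.
  pose phi (z : TX * bool * bool * R) : bool * TX * R :=
    (z.1.1.2, z.1.1.1, (z.1.2 == m)%:R).
  have mphi : measurable_fun setT phi.
    apply: measurable_fun_pair; first exact: measurable_fun_pair.
    exact: measurable_eqbR.
  have phiE U : (fun w => (expA U w, covX U w, \1_[set w | medM U w = m] w : R)) =
      (fun w => phi (covX U w, expA U w, medM U w, outY U w)).
    by apply/funext => w; rewrite indic_eq_event.
  by rewrite (phiE V) (phiE V'); exact: law_map.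
- exact/integrable_indic1/measurable_bool_event.
- exact/integrable_indic1/measurable_bool_event.
Qed.

Lemma same_law_muY a m x :
  (Pr V).-integrable setT (fun w => (outY V w)%:E) ->
  (Pr V').-integrable setT (fun w => (outY V' w)%:E) ->
  muY V a m x = muY V' a m x.
Proof.
move=> iY iY'; rewrite /muY.
have [mX mA mM mY] := RVm V; have [mX' mA' mM' mY'] := RVm V'.
congr (_ _); apply: same_law_condexp => //.
- by apply: measurable_fun_pair => //; exact: measurable_fun_pair.
- by apply: measurable_fun_pair => //; exact: measurable_fun_pair.
- move=> B mB.
  apply: (law_map (phi := fun z => (z.1.1.2, z.1.2, z.1.1.1, z.2))) => //.
  apply: measurable_fun_pair; last exact: measurable_snd.
  by apply: measurable_fun_pair => //; exact: measurable_fun_pair.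
Qed.

End same_law.

(** * The two parts as the cases b = 0 and b = 1 *)

Lemma finite_means_diag (R : realType) (dX : measure_display)
    (TX : measurableType dX) (V : setting R TX) (b : bool) :
  finite_means V b -> forall a, Ycross_integrable V a a.
Proof. by case: b => -[i0 i1 i2] []. Qed.

Lemma finite_means_arm (R : realType) (dX : measure_display)
    (TX : measurableType dX) (V : setting R TX) (b : bool) :
  finite_means V b -> forall a, Ycross_integrable V a b.
Proof. by move=> -[i0 i1 i2] []. Qed.

Theorem theorem2p3 (R : realType) (dX : measure_display)
    (TX : measurableType dX) (V : setting R TX) (hV : assumptions V) :
  (* Part I *)
  (sufficiency_under_control V -> finite_means V false ->
    (forall a, 'E_(Pr V)[Ycross V a false] =
       \int[lawX V]_x (\sum_(m : bool) muY V a m x * pM V m false x)%R%:E) /\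
    (forall s, 0 < pS V s ->
       Delta_dir V s =
         \int[lawX_given_S V s]_x (muY V true s x - muY V false s x)%R%:E /\
       forall B : set TX, measurable B ->
         lawX_given_S V s B =
         (\int[lawX V]_(x in B) (pM V s false x)%:E) /
         (\int[lawX V]_x (pM V s false x)%:E)) /\
    (0 < pS V true ->
       Delta_indir_c V =
         (\int[lawX V]_x (pM V true false x)%:E)^-1 *
         \int[lawX V]_x
           (\sum_(m : bool) muY V true m x * (pM V m true x - pM V m false x))%R%:E) /\
    direct_effect V false =
      Delta_dir V true * pS V true + Delta_dir V false * pS V false /\
    indirect_effect V true = Delta_indir_c V * pS V true /\
    (forall s, pS V s = \int[lawX V]_x (pM V s false x)%:E) /\
    (* identification from the law of (X, A, M, Y) *)
    (forall V' : setting R TX, assumptions V' ->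
       sufficiency_under_control V' -> finite_means V' false ->
       same_observed_law V V' ->
       direct_effect V false = direct_effect V' false /\
       indirect_effect V true = indirect_effect V' true))
  /\
  (* Part II *)
  (sufficiency_under_treatment V -> finite_means V true ->
    (forall a, 'E_(Pr V)[Ycross V a true] =
       \int[lawX V]_x (\sum_(m : bool) muY V a m x * pM V m true x)%R%:E) /\
    (forall s, 0 < pS V s ->
       Delta_dir V s =
         \int[lawX_given_S V s]_x (muY V true s x - muY V false s x)%R%:E /\
       forall B : set TX, measurable B ->
         lawX_given_S V s B =
         (\int[lawX V]_(x in B) (pM V s true x)%:E) /
         (\int[lawX V]_x (pM V s true x)%:E)) /\
    (0 < pS V true ->
       Delta_indir_t V =
         (\int[lawX V]_x (pM V true true x)%:E)^-1 *
         \int[lawX V]_x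
           (\sum_(m : bool) muY V false m x * (pM V m true x - pM V m false x))%R%:E) /\
    direct_effect V true =
      Delta_dir V true * pS V true + Delta_dir V false * pS V false /\
    indirect_effect V false = Delta_indir_t V * pS V true /\
    (forall s, pS V s = \int[lawX V]_x (pM V s true x)%:E)).
Proof.
have key b : marker_response V b true 1%R -> finite_means V b ->
    [/\ {ae Pr V, forall w, potM V b w = mrkS V w},
      (Pr V).-integrable setT (fun w => (outY V w)%:E),
      forall a, Ycross_integrable V a a & forall a, Ycross_integrable V a b].
  move=> hb fm; split.
  - exact: sufficiency_ae.
  - exact/outY_integrable/finite_means_diag/fm.
  - exact: finite_means_diag fm.
  - exact: finite_means_arm fm.
split=> hs fm.
- have [MS iY ia iC] := key _ hs fm.
  have ab c : c = true \/ c = false by case: c; [left|right].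
  have mZ : measurable_fun setT (fun w => Ya V true w - potY V true true w)%R.
    by apply: measurable_funB; [exact/measurable_Ya/ia|exact: measurable_funPT].
  have IE : indirect_effect V true = Delta_indir_c V * pS V true.
    apply: (indirect_effect_given_S iC ab (ia true) mZ).
    exact: Ya_sub_ae.
  split; [|split; [|split; [|split; [|split; [|split]]]]].
  + by move=> a; apply: (expectation_Ycross hV MS iY); [right|exact: iC].
  + move=> s ps; split; first exact: (Delta_dirE hV MS iY iC).
    by move=> B mB; exact: (lawX_given_SE hV MS).
  + move=> ps.
    (* The integral is the unconditional indirect effect, which is also the conditional one times
       P(S_M = 1); the positive finite factor cancels. *)
    rewrite -(indirect_effectE hV MS iY iC ab (ia true)) IE -(pS_pM hV MS).
    by rewrite muleCA [X in _ * X]muleC divee ?mule1 ?pS_fin_num// gt_eqF.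
  + exact: (direct_effect_decomp hV MS iY iC).
  + exact: IE.
  + by move=> s; exact: (pS_pM hV MS).
  + move=> V' hV' hs' fm' law.
    have iC' := finite_means_arm fm'.
    have ia' := finite_means_diag fm'.
    have MS' := sufficiency_ae hV' hs'.
    have iY' := outY_integrable hV' ia'.
    split.
    (* Both settings give the same observed functional: the laws of X agree, and the chosen versions
       are equal as functions. *)
    * rewrite (direct_effectE hV MS iY iC) (direct_effectE hV' MS' iY' iC').
      rewrite !(same_law_lawX law).
      by congr (_ - _); apply: eq_integral => x _; congr EFin; apply: eq_bigr => m _;
        rewrite (same_law_muY law _ _ _ iY iY') (same_law_pM law).
    * rewrite (indirect_effectE hV MS iY iC ab (ia true)).
      rewrite (indirect_effectE hV' MS' iY' iC' ab (ia' true)).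
      rewrite (same_law_lawX law).
      apply: eq_integral => x _; congr EFin; apply: eq_bigr => m _.
      by rewrite (same_law_muY law _ _ _ iY iY') !(same_law_pM law).
- have [MS iY ia iC] := key _ hs fm.
  have ab c : c = false \/ c = true by case: c; [right|left].
  have mZ : measurable_fun setT (fun w => potY V false true w - Ya V false w)%R.
    by apply: measurable_funB; [exact: measurable_funPT|exact/measurable_Ya/ia].
  have IE : indirect_effect V false = Delta_indir_t V * pS V true.
    apply: (indirect_effect_given_S iC ab (ia false) mZ).
    (* With a = 0 and b = 1 the general identity gives the negative of the contrast wanted, so signs
       are flipped on both sides. *)
    apply: filterS (Ya_sub_ae hV MS false) => w e.
    by rewrite -opprB mulNr e opprB.
  split; [|split; [|split; [|split; [|split]]]].
  + by move=> a; apply: (expectation_Ycross hV MS iY); [right|exact: iC].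
  + move=> s ps; split; first exact: (Delta_dirE hV MS iY iC).
    by move=> B mB; exact: (lawX_given_SE hV MS).
  + move=> ps.
    rewrite -(indirect_effectE hV MS iY iC ab (ia false)) IE -(pS_pM hV MS).
    by rewrite muleCA [X in _ * X]muleC divee ?mule1 ?pS_fin_num// gt_eqF.
  + exact: (direct_effect_decomp hV MS iY iC).
  + exact: IE.
  + by move=> s; exact: (pS_pM hV MS).
Qed.
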